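(* Let $M$ be a compact $7$-manifold without boundary and let $\beta$ be a smooth $2$-form on $M$ such that $\varphi = d\beta$ is a $G_2$-structure on $M$ (an exact $G_2$-structure). Decompose $\beta=\beta_7+\beta_{14}$ with $\beta_7\in\Omega^2_7(M)$ and $\beta_{14}\in\Omega^2_{14}(M)$ with respect to $\varphi$. Then $$2\,\|\beta_7\|^2_{L^2}=\|\beta_{14}\|^2_{L^2}.$$
   Context: A $G_2$-structure on a $7$-manifold $M$ is given by a positive $3$-form $\varphi$, i.e. a smooth $3$-form which at each point is identified, by some linear isomorphism $T_pM\cong\mathbb{R}^7$, with $\varphi_0 = dx^{123} - dx^{167} - dx^{527} - dx^{563} + dx^{415} + dx^{426} + dx^{437}$. It determines a Riemannian metric $g_\varphi$ and an orientation (so that for $\varphi_0$ they are the standard ones on $\mathbb{R}^7$), hence a volume form $\mathrm{vol}$ and Hodge star $*$. Pointwise norms of forms satisfy $\alpha\wedge *\alpha=|\alpha|^2\mathrm{vol}$, and $\|\alpha\|_{L^2}^2=\int_M|\alpha|^2\,\mathrm{vol}$. The $2$-forms split pointwise orthogonally as $\Lambda^2=\Lambda^2_7\oplus\Lambda^2_{14}$, where $\Lambda^2_7=\{\beta: *(\varphi\wedge\beta)=2\beta\}$ and $\Lambda^2_{14}=\{\beta: *(\varphi\wedge\beta)=-\beta\}$; $\Omega^2_7(M),\Omega^2_{14}(M)$ denote the corresponding smooth sections. *)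

(* Defs.v *)
From HB Require Import structures.
From mathcomp Require Import all_boot all_order all_algebra all_fingroup.
From mathcomp Require Import all_classical all_reals all_analysis.
Set Implicit Arguments.
Unset Strict Implicit.
Unset Printing Implicit Defensive.
Import Order.TTheory GRing.Theory Num.Theory.
Import numFieldNormedType.Exports.
Local Open Scope classical_set_scope.
Local Open Scope ring_scope.

(** * Exterior algebra of R^n

    Vectors are rows; a k-tuple of vectors is a k x n matrix, and a linear map
    acts by multiplication on the right. *)

Section ExteriorAlgebra.
Variables (R : realType) (n : nat).

Definition kform (k : nat) : Type := 'M[R]_(k, n) -> R.

Definition multilinear k (a : kform k) : Prop :=
  forall (i : 'I_k) (b c : R) (U V W : 'M[R]_(k, n)),
    row i U = b *: row i V + c *: row i W ->
    row' i V = row' i U -> row' i W = row' i U ->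
    a U = b * a V + c * a W.

Definition alternating_form k (a : kform k) : Prop :=
  multilinear a /\
  forall (V : 'M[R]_(k, n)) (i j : 'I_k),
    i != j -> row i V = row j V -> a V = 0.

Definition wedge k l (a : kform k) (b : kform l) : kform (k + l) := fun V =>
  (k`! * l`!)%:R^-1 *
  \sum_(s : 'S_(k + l)) (-1) ^+ s *
    a (usubmx (row_perm s V)) * b (dsubmx (row_perm s V)).

(** The rows of [frame f] are the basis vectors e_(f 0), ..., e_(f (k-1)). *)
Definition frame k (f : {ffun 'I_k -> 'I_n}) : 'M[R]_(k, n) := rowsub f 1%:M.

(** In the next two definitions [G] is the Gram matrix G_ij = g(e_i, e_j) of an
    inner product g. *)

(** <a, b> = 1/k! a_(i1...ik) b_(j1...jk) g^(i1 j1) ... g^(ik jk), so that the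
    e^(i1) /\ ... /\ e^(ik), i1 < ... < ik, are orthonormal whenever (e_i) is. *)
Definition form_dot (G : 'M[R]_n) k (a b : kform k) : R :=
  k`!%:R^-1 *
  \sum_(f : {ffun 'I_k -> 'I_n}) \sum_(h : {ffun 'I_k -> 'I_n})
    (\prod_(r < k) invmx G (f r) (h r)) * a (frame f) * b (frame h).

Definition form_norm2 (G : 'M[R]_n) k (a : kform k) : R := form_dot G a a.

(** ( *a)_(j1...jl) = 1/k! a^(i1...ik) vol_(i1...ik j1...jl), where k + l = n:
    this is the l-form such that b /\ *a = <b, a> vol for every k-form b. *)
Definition hodge_star (G : 'M[R]_n) k l (vol : kform (k + l)) (a : kform k) :
    kform l := fun W =>
  k`!%:R^-1 *
  \sum_(f : {ffun 'I_k -> 'I_n}) \sum_(h : {ffun 'I_k -> 'I_n})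
    (\prod_(r < k) invmx G (f r) (h r)) *
    a (frame f) * vol (col_mx (frame h) W).

(** Exterior derivative of a k-form on (an open subset of) R^n:
    dw(v_0, ..., v_k) = sum_i (-1)^i D_(v_i) w(v_0, ..., ^v_i, ..., v_k). *)
Definition dform k (w : 'rV[R]_n -> kform k) : 'rV[R]_n -> kform k.+1 :=
  fun x V => \sum_(i < k.+1)
    (-1) ^+ i * 'D_(row i V) (fun y => w y (row' i V)) x.

End ExteriorAlgebra.

Definition pullback (R : realType) (n m k : nat) (A : 'M[R]_(n, m))
  (a : kform R m k) : kform R n k := fun V => a (V *m A).

(** * Smooth maps on open sets *)

Fixpoint Ck (R : realType) (V W : normedModType R) (k : nat) (U : set V)
    (f : V -> W) : Prop :=
  if k is k'.+1 then
    (forall x, U x -> differentiable f x) /\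
    (forall v : V, Ck k' U (fun x => 'D_v f x))
  else forall x, U x -> {for x, continuous f}.

Definition smooth (R : realType) (V W : normedModType R) (U : set V)
  (f : V -> W) : Prop := forall k, Ck k U f.

(** * Smooth manifolds *)

(** [crd_inv] and [crd] are only meaningful on [chart_rng] and [chart_dom]. *)
Record chart (R : realType) (n : nat) (M : Type) := Chart {
  chart_dom : set M;
  crd : M -> 'rV[R]_n;
  crd_inv : 'rV[R]_n -> M }.

Definition chart_rng (R : realType) n (M : Type) (c : chart R n M) : set 'rV[R]_n :=
  crd c @` chart_dom c.

(** An n-dimensional smooth manifold structure (without boundary).  As the
    tangent space at p we use R^n, identified with T_pM by means of the
    preferred chart [chart_at p]. *)
Record manifold (R : realType) (n : nat) (M : topologicalType) := Manifold {
  atlas : set (chart R n M);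
  chart_at : M -> chart R n M;
  manifold_hausdorff : hausdorff_space M;
  manifold_second_countable : @second_countable M;
  atlas_chart_at : forall p, atlas (chart_at p);
  dom_chart_at : forall p, chart_dom (chart_at p) p;
  open_dom : forall c, atlas c -> open (chart_dom c);
  open_rng : forall c, atlas c -> open (chart_rng c);
  crdK : forall c, atlas c -> forall p, chart_dom c p -> crd_inv c (crd c p) = p;
  crd_continuous : forall c, atlas c ->
    forall p, chart_dom c p -> {for p, continuous (crd c)};
  crd_inv_continuous : forall c, atlas c ->
    forall x, chart_rng c x -> {for x, continuous (crd_inv c)};
  transition_smooth : forall c c', atlas c -> atlas c' ->
    smooth (crd c @` (chart_dom c `&` chart_dom c')) (crd c' \o crd_inv c) }.

Section Fields.
Variables (R : realType) (n : nat) (M : topologicalType) (X : manifold R n M).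

(** The differential at x of the inverse of c, as a map from R^n to the tangent
    space at [crd_inv c x]. *)
Definition chart_jac (c : chart R n M) (x : 'rV[R]_n) : 'M[R]_n :=
  'J (crd (chart_at X (crd_inv c x)) \o crd_inv c) x.

(** A section of the bundle of k-forms is a function [M -> kform R n k]; its
    expression in the chart c is a k-form on [chart_rng c]. *)
Definition local_form k (w : M -> kform R n k) (c : chart R n M) :
    'rV[R]_n -> kform R n k :=
  fun x => pullback (chart_jac c x) (w (crd_inv c x)).

Definition local_metric (g : M -> 'M[R]_n) (c : chart R n M) :
    'rV[R]_n -> 'M[R]_n :=
  fun x => chart_jac c x *m g (crd_inv c x) *m (chart_jac c x)^T.

Definition smooth_form k (w : M -> kform R n k) : Prop :=
  (forall p, alternating_form (w p)) /\
  (forall c, atlas X c -> forall V : 'M[R]_(k, n),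
     smooth (chart_rng c) (fun x => (local_form w c x V : R^o))).

Definition is_exterior_derivative k (w : M -> kform R n k)
    (dw : M -> kform R n k.+1) : Prop :=
  forall c, atlas X c -> forall x, chart_rng c x ->
    local_form dw c x =1 dform (local_form w c) x.

End Fields.

(** * The Riemannian measure *)

Definition R7 (R : realType) : Type := (R * R * R * R * R * R * R)%type.

Definition row7 (R : realType) (t : R7 R) : 'rV[R]_7 :=
  let: (x1, x2, x3, x4, x5, x6, x7) := t in
  \row_(i < 7) [:: x1; x2; x3; x4; x5; x6; x7]`_i.

Definition lebesgue7 (R : realType) :=
  ((@lebesgue_measure R \x @lebesgue_measure R \x @lebesgue_measure R \x
    @lebesgue_measure R \x @lebesgue_measure R \x @lebesgue_measure R \x
    @lebesgue_measure R))%E.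

Definition borel (M : ptopologicalType) := g_sigma_algebraType (@open M).

(** mu is the Riemannian measure of g, given in every chart by
    sqrt(det(g_ij)) dx^1 ... dx^7. *)
Definition is_riemannian_measure (R : realType) (M : ptopologicalType)
    (X : manifold R 7 M) (g : M -> 'M[R]_7)
    (mu : {measure set (borel M) -> \bar R}) : Prop :=
  forall c, atlas X c -> forall A : set (borel M), measurable A ->
    A `<=` chart_dom c ->
    mu A = (\int[@lebesgue7 R]_(t in @row7 R @^-1` (crd c @` A))
              (Num.sqrt (\det (local_metric X g c (row7 t))))%:E)%E.

Definition L2_norm2 (R : realType) (M : ptopologicalType) (n : nat)
    (g : M -> 'M[R]_n) (mu : {measure set (borel M) -> \bar R})
    (k : nat) (w : M -> kform R n k) : \bar R :=
  (\int[mu]_(p in [set: borel M]) (form_norm2 (g p) (w p))%:E)%E.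

(** * G2-structures *)

Section G2.
Variable R : realType.

(** dx^(ijk), with 1 <= i, j, k <= 7. *)
Definition dx3 (i j k : nat) : kform R 7 3 := fun V =>
  \det (\matrix_(a < 3, b < 3) V a (inord (nth 0%N [:: i; j; k] b).-1)).

Definition phi0 : kform R 7 3 := fun V =>
  dx3 1 2 3 V - dx3 1 6 7 V - dx3 5 2 7 V - dx3 5 6 3 V
  + dx3 4 1 5 V + dx3 4 2 6 V + dx3 4 3 7 V.

Definition positive_form (phi : kform R 7 3) : Prop :=
  exists2 A : 'M[R]_7, A \in unitmx & phi =1 pullback A phi0.

(** [G] and [vol] are the Gram matrix and the (oriented) volume form determined
    by phi: some linear isomorphism v |-> v *m A carries phi0, the standard
    inner product and the standard volume form to phi, G and vol. *)
Definition G2_metric_vol (phi : kform R 7 3) (G : 'M[R]_7) (vol : kform R 7 7) :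
    Prop :=
  exists2 A : 'M[R]_7, A \in unitmx &
    [/\ phi =1 pullback A phi0,
        G = A *m A^T &
        vol =1 pullback A (fun V : 'M[R]_7 => \det V)].

Definition star_phi_wedge (phi : kform R 7 3) (G : 'M[R]_7) (vol : kform R 7 7)
    (b : kform R 7 2) : kform R 7 2 :=
  @hodge_star R 7 G 5 2 vol (wedge phi b).

Definition Lambda2_7 phi G vol (b : kform R 7 2) : Prop :=
  alternating_form b /\ forall V, star_phi_wedge phi G vol b V = 2 * b V.

Definition Lambda2_14 phi G vol (b : kform R 7 2) : Prop :=
  alternating_form b /\ forall V, star_phi_wedge phi G vol b V = - b V.

Variables (M : topologicalType) (X : manifold R 7 M).

Definition G2_structure (phi : M -> kform R 7 3) : Prop :=
  smooth_form X phi /\ forall p, positive_form (phi p).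

Definition Omega2_7 phi g vol (b : M -> kform R 7 2) : Prop :=
  smooth_form X b /\ forall p, Lambda2_7 (phi p) (g p) (vol p) (b p).

Definition Omega2_14 phi g vol (b : M -> kform R 7 2) : Prop :=
  smooth_form X b /\ forall p, Lambda2_14 (phi p) (g p) (vol p) (b p).

End G2.

(* Main.v *)
(** Pointwise, *(phi /\ b) = 2 b on Lambda^2_7 and *(phi /\ b) = - b on
    Lambda^2_14, so phi /\ beta /\ beta = (2 |beta_7|^2 - |beta_14|^2) vol.  As
    phi = d beta, the left-hand side is d(beta^3) / 3, whose integral vanishes by
    Stokes' theorem.

    With a C^1 partition of unity (f_i), Stokes' theorem reduces to the vanishing
    of the integral of d(f_i beta^3), supported in a ball of one chart; there it
    is the divergence of a compactly supported C^1 vector field, and Fubini and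
    the fundamental theorem of calculus apply.

    The volume form is only given pointwise.  That it is continuous, and so
    orients the charts locally, follows from Bryant's formula: the Gram matrix of
    (u, v) |-> (u |_ phi) /\ (v |_ phi) /\ phi has determinant c (det A)^9 when
    phi = A^* phi_0, and the ninth root is continuous. *)

Require Import Defs.
From HB Require Import structures.
From mathcomp Require Import all_boot all_order all_algebra all_fingroup.
From mathcomp Require Import all_classical all_reals all_analysis.
From mathcomp Require Import measurable_realfun ring lra.
Set Implicit Arguments.
Unset Strict Implicit.
Unset Printing Implicit Defensive.
Import Order.TTheory GRing.Theory Num.Theory.
Import numFieldNormedType.Exports.
Local Open Scope classical_set_scope.
Local Open Scope ring_scope.

(** * Multilinear and alternating forms *)

(** A top-degree form is represented by one number, its value on the identity matrix, and a product
    of forms by the unnormalised alternation [alt] of their tensor product; 24 = 3! 2! 2! converts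
    [alt] into phi /\ b /\ c. Dividing by the value of [vol] gives a function on M that is the same
    in every chart and insensitive to orientation.

    Like the volume form, the metric is given only pointwise. The eigenvalue equations bypass this:
    they make |beta_7|^2 and |beta_14|^2 constant multiples of phi /\ b /\ b divided by vol, which
    is continuous once vol is. This is where the integrability comes from that allows the final
    integral to be split. The same equations give the orthogonality of the two components, because
    (b, c) -> phi /\ b /\ c is symmetric and the eigenvalues 2 and -1 differ.

    The measure sees only the absolute value of the volume coefficient, whereas the divergence comes
    with its sign; this is why the balls carrying the partition of unity are chosen with constant
    sign. *)

Definition fcons (I : finType) k (j : I) (g : {ffun 'I_k -> I}) :
    {ffun 'I_k.+1 -> I} :=
  [ffun i => if unlift ord0 i is Some i' then g i' else j].

Lemma sum_fcons (V : nmodType) (I : finType) k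
    (P : {ffun 'I_k.+1 -> I} -> V) :
  \sum_f P f = \sum_j \sum_(g : {ffun 'I_k -> I}) P (fcons j g).
Proof.
rewrite pair_big /=.
rewrite (reindex (fun p : I * {ffun 'I_k -> I} => fcons p.1 p.2)) //=.
exists (fun f => (f ord0, [ffun i => f (lift ord0 i)])) => [[j g] _|f _] /=.
  congr pair; first by rewrite ffunE unlift_none.
  by apply/ffunP => i; rewrite !ffunE liftK.
by apply/ffunP => i; rewrite ffunE; case: unliftP => [i'|] ->; rewrite ?ffunE.
Qed.

Section Multilinear.
Variables (R : realType) (n : nat).
Local Notation kform := (kform R n).

Definition mx_cons k (w : 'rV[R]_n) (V : 'M[R]_(k, n)) : 'M[R]_(k.+1, n) :=
  \matrix_(i, j) if unlift ord0 i is Some i' then V i' j else w 0 j.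

Lemma row0_mx_cons k w (V : 'M[R]_(k, n)) : row ord0 (mx_cons w V) = w.
Proof. by apply/rowP => j; rewrite !mxE unlift_none. Qed.

Lemma row_mx_cons k w (V : 'M[R]_(k, n)) i :
  row (lift ord0 i) (mx_cons w V) = row i V.
Proof. by apply/rowP => j; rewrite !mxE liftK. Qed.

Lemma row'0_mx_cons k w (V : 'M[R]_(k, n)) : row' ord0 (mx_cons w V) = V.
Proof. by apply/matrixP => i j; rewrite !mxE liftK. Qed.

Lemma mx_consE k (V : 'M[R]_(k.+1, n)) :
  V = mx_cons (row ord0 V) (row' ord0 V).
Proof. by apply/matrixP => i j; rewrite !mxE; case: unliftP => [x|] ->; rewrite ?mxE. Qed.

Lemma frame_fcons k j (g : {ffun 'I_k -> 'I_n}) :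
  frame R (fcons j g) = mx_cons (delta_mx 0 j) (frame R g).
Proof.
by apply/matrixP => x y; rewrite !mxE ffunE; case: unliftP => [x'|] _;
  rewrite ?mxE // eqxx eq_sym.
Qed.

Lemma multilinear_cons k (a : kform k.+1) w :
  multilinear a -> multilinear (fun V : 'M[R]_(k, n) => a (mx_cons w V)).
Proof.
move=> ma i b c U V W UE VE WE.
have row'_cons (A B : 'M[R]_(k, n)) : row' i A = row' i B ->
    row' (lift ord0 i) (mx_cons w A) = row' (lift ord0 i) (mx_cons w B).
  move=> /matrixP AB; apply/matrixP => x y; rewrite !mxE.
  case: unliftP => // x' xx'.
  case: (unliftP i x') xx' => [z -> _|-> /eqP]; first by have := AB z y; rewrite !mxE.
  by rewrite eq_sym (negPf (neq_lift _ _)).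
by apply: (ma (lift ord0 i)); rewrite ?row_mx_cons //; exact: row'_cons.
Qed.

Lemma multilinear_row0 k (a : kform k.+1) (u : 'rV[R]_n) (V : 'M[R]_(k, n)) :
  multilinear a ->
  a (mx_cons u V) = \sum_j u 0 j * a (mx_cons (delta_mx 0 j) V).
Proof.
move=> ma; rewrite [in LHS](row_sum_delta u).
(* This is the base of the induction on the index list: a zero row is the combination 0 V + 0 W. *)
have a0 : a (mx_cons 0 V) = 0.
  rewrite (ma ord0 0 0 _ (mx_cons 0 V) (mx_cons 0 V)) ?mul0r ?addr0 //.
  by rewrite !row0_mx_cons scaler0 addr0.
elim: (index_enum _) => [|j r IH]; first by rewrite !big_nil.
rewrite !big_cons -IH (ma ord0 (u 0 j) 1 _ (mx_cons (delta_mx 0 j) V)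
  (mx_cons (\sum_(j <- r) u 0 j *: delta_mx 0 j) V)) ?mul1r //.
- by rewrite !row0_mx_cons scale1r.
- by rewrite !row'0_mx_cons.
- by rewrite !row'0_mx_cons.
Qed.

(** Expand the first row and induct. The sum runs over all index maps, to match the sums in
    [form_dot] and [hodge_star]. *)
Lemma multilinear_expand k (a : kform k) (V : 'M[R]_(k, n)) :
  multilinear a ->
  a V = \sum_(f : {ffun 'I_k -> 'I_n}) (\prod_(r < k) V r (f r)) * a (frame R f).
Proof.
elim: k a V => [|k IH] a V ma.
  rewrite (eq_bigr (fun=> a V)) => [|f _]; last first.
    by rewrite big_ord0 mul1r; congr a; apply/matrixP => -[].
  by rewrite sumr_const card_ffun !card_ord expn0 mulr1n.
rewrite [in LHS](mx_consE V) multilinear_row0 // sum_fcons.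
apply: eq_bigr => j _; rewrite (IH _ _ (multilinear_cons _ ma)) big_distrr /=.
apply: eq_bigr => g _.
rewrite frame_fcons big_ord_recl !mulrA !mxE !ffunE unlift_none.
by congr (_ * _ * _); apply: eq_bigr => r _; rewrite ffunE liftK !mxE.
Qed.

End Multilinear.

(** * Alternation and iterated wedge products *)

Section Alternation.
Variables (R : realType) (n : nat).
Local Notation kform := (kform R n).

(** There is no factor 1/k!: integer coefficients stay integers, so that Bryant's form of [phi0] can
    be evaluated by computation. *)
Definition alt k (F : kform k) : kform k :=
  fun V => \sum_(s : 'S_k) (-1) ^+ s * F (row_perm s V).

Definition tens k l (a : kform k) (b : kform l) : kform (k + l) :=
  fun V => a (usubmx V) * b (dsubmx V).

Lemma eq_alt k (F F' : kform k) : F =1 F' -> alt F =1 alt F'.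
Proof. by move=> FF' V; apply: eq_bigr => s _; rewrite FF'. Qed.

Lemma altD k (F F' : kform k) V : alt (fun V => F V + F' V) V = alt F V + alt F' V.
Proof. by rewrite -big_split; apply: eq_bigr => s _; rewrite mulrDr. Qed.

Lemma altZ k c (F : kform k) V : alt (fun V => c * F V) V = c * alt F V.
Proof. by rewrite big_distrr; apply: eq_bigr => s _; rewrite mulrCA. Qed.

Lemma alt_row_perm k (F : kform k) (t : 'S_k) V :
  alt (fun V => F (row_perm t V)) V = (-1) ^+ t * alt F V.
Proof.
rewrite /alt [in RHS](reindex_inj (mulgI t)) big_distrr /=.
apply: eq_bigr => s _; rewrite odd_permM signr_addb row_permM !mulrA.
by rewrite -signr_addb addbb mul1r.
Qed.

Lemma row_perm_mulmx k m (s : 'S_k) (V : 'M[R]_(k, m)) p (A : 'M[R]_(m, p)) :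
  row_perm s (V *m A) = row_perm s V *m A.
Proof. by rewrite !row_permE mulmxA. Qed.

Lemma multilinear_tens k l (a : kform k) (b : kform l) :
  multilinear a -> multilinear b -> multilinear (tens a b).
Proof.
move=> ma mb i c d U V W UE VE WE; rewrite /tens.
have sub_eq (A : 'M[R]_(k + l, n)) : row' i A = row' i U ->
    forall j y, j != i -> A j y = U j y.
  move=> /matrixP AU j y; case: (unliftP i j) => [z ->|->]; last by rewrite eqxx.
  by have := AU z y; rewrite !mxE.
have row'P m (A B : 'M[R]_(m, n)) j :
    (forall x y, x != j -> A x y = B x y) -> row' j A = row' j B.
  by move=> AB; apply/matrixP => x y; rewrite !mxE AB // eq_sym neq_lift.
have /rowP rowE := UE.
case: (splitP i) => [i' ii'|i' ii'].
- have iE : i = lshift l i' by apply/val_inj.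
  have dE A : row' i A = row' i U -> dsubmx A = dsubmx U.
    move=> /sub_eq AU; apply/matrixP => x y; rewrite !mxE AU // iE.
    by rewrite eq_rlshift.
  rewrite (dE _ VE) (dE _ WE) (ma i' c d _ (usubmx V) (usubmx W)).
  + by rewrite mulrDl !mulrA.
  + by apply/rowP => j; have := rowE j; rewrite !mxE iE.
  + by apply: row'P => x y xi; rewrite !mxE sub_eq // iE eq_lshift.
  + by apply: row'P => x y xi; rewrite !mxE sub_eq // iE eq_lshift.
- have iE : i = rshift k i' by apply/val_inj.
  have uE A : row' i A = row' i U -> usubmx A = usubmx U.
    move=> /sub_eq AU; apply/matrixP => x y; rewrite !mxE AU // iE.
    by rewrite eq_lrshift.
  rewrite (uE _ VE) (uE _ WE) (mb i' c d _ (dsubmx V) (dsubmx W)).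
  + by rewrite mulrDr !(mulrCA (a _)).
  + by apply/rowP => j; have := rowE j; rewrite !mxE iE.
  + by apply: row'P => x y xi; rewrite !mxE sub_eq // iE eq_rshift.
  + by apply: row'P => x y xi; rewrite !mxE sub_eq // iE eq_rshift.
Qed.

Lemma wedge_alt k l (a : kform k) (b : kform l) V :
  wedge a b V = (k`! * l`!)%:R^-1 * alt (tens a b) V.
Proof. by congr (_ * _); apply: eq_bigr => s _; rewrite -mulrA. Qed.

Definition perm_lshift_fun k l (s : 'S_k) (i : 'I_(k + l)) : 'I_(k + l) :=
  match fintype.split i with inl j => lshift l (s j) | inr _ => i end.

Lemma perm_lshift_inj k l (s : 'S_k) : injective (@perm_lshift_fun k l s).
Proof.
move=> i j; rewrite /perm_lshift_fun.
case: (splitP i) => i' ii'; case: (splitP j) => j' jj' e.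
- have /lshift_inj /perm_inj i'j' := e.
  by apply/val_inj; rewrite /= ii' jj' i'j'.
- by move/(congr1 val): e => /= e; have := ltn_ord (s i'); rewrite e jj' ltnNge leq_addr.
- by move/(congr1 val): e => /= e; have := ltn_ord (s j'); rewrite -e ii' ltnNge leq_addr.
- by [].
Qed.

Definition perm_lshift k l (s : 'S_k) : 'S_(k + l) := perm (@perm_lshift_inj k l s).

Lemma perm_lshiftL k l (s : 'S_k) i : perm_lshift l s (lshift l i) = lshift l (s i).
Proof. by rewrite permE /perm_lshift_fun (unsplitK (inl i)). Qed.

Lemma perm_lshiftR k l (s : 'S_k) i : perm_lshift l s (rshift k i) = rshift k i.
Proof. by rewrite permE /perm_lshift_fun (unsplitK (inr i)). Qed.

(** The sign is the determinant of the permutation matrix, which is block diagonal with blocks the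
    matrix of [s] and the identity. *)
Lemma odd_perm_lshift k l (s : 'S_k) : odd_perm (perm_lshift l s) = odd_perm s.
Proof.
suff : (-1) ^+ perm_lshift l s = (-1) ^+ s :> int.
  by case: (odd_perm _); case: (odd_perm _).
rewrite -[LHS]det_perm -[RHS]det_perm.
have -> : perm_mx (perm_lshift l s) = block_mx (perm_mx s) 0 0 1%:M :> 'M[int]_(k + l).
  apply/matrixP => i j; rewrite !mxE.
  case: splitP => i' ii'; rewrite !mxE; case: splitP => j' jj'; rewrite !mxE.
  - have -> : i = lshift l i' by apply/val_inj.
    have -> : j = lshift l j' by apply/val_inj.
    by rewrite perm_lshiftL eq_lshift.
  - have -> : i = lshift l i' by apply/val_inj.
    have -> : j = rshift k j' by apply/val_inj.
    by rewrite perm_lshiftL eq_lrshift.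
  - have -> : i = rshift k i' by apply/val_inj.
    have -> : j = lshift l j' by apply/val_inj.
    by rewrite perm_lshiftR eq_rlshift.
  - have -> : i = rshift k i' by apply/val_inj.
    have -> : j = rshift k j' by apply/val_inj.
    by rewrite perm_lshiftR eq_rshift.
by rewrite det_ublock det1 mulr1.
Qed.

(** Each of the k! permutations of the inner alternation extends to all k + l slots and is absorbed
    by the outer one, where its sign appears a second time and cancels. *)
Lemma alt_tens_alt k l (a : kform k) (b : kform l) V :
  alt (tens (alt a) b) V = k`!%:R * alt (tens a b) V.
Proof.
transitivity (\sum_(t : 'S_k) (-1) ^+ t *
    alt (fun V => tens a b (row_perm (perm_lshift l t) V)) V).
  rewrite /alt; under [RHS]eq_bigr => t _ do rewrite big_distrr.
  rewrite exchange_big /=; apply: eq_bigr => s _.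
  rewrite /tens /alt !big_distrl big_distrr /=; apply: eq_bigr => t _.
  rewrite -!mulrA [LHS]mulrCA; congr (_ * (_ * (a _ * b _))).
    by apply/matrixP => i j; rewrite !mxE perm_lshiftL.
  by apply/matrixP => i j; rewrite !mxE perm_lshiftR.
rewrite (eq_bigr (fun=> alt (tens a b) V)) => [|t _].
  by rewrite sumr_const card_Sn mulr_natl.
by rewrite alt_row_perm odd_perm_lshift mulrA -signr_addb addbb mul1r.
Qed.

(** The (k + l)! in the outer denominator cancels against the inner alternation. *)
Lemma wedge3_alt k l m (a : kform k) (b : kform l) (c : kform m) V :
  wedge (wedge a b) c V =
  (k`! * l`! * m`!)%:R^-1 * alt (tens (tens a b) c) V.
Proof.
rewrite wedge_alt (eq_alt (F' := fun V => (k`! * l`!)%:R^-1 *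
    tens (alt (tens a b)) c V)); last first.
  by move=> W; rewrite /tens wedge_alt mulrA.
rewrite altZ alt_tens_alt !mulrA; congr (_ * _).
rewrite !natrM !invfM.
have h p : p`!%:R != 0 :> R by rewrite pnatr_eq0 -lt0n fact_gt0.
by field; rewrite !h.
Qed.

End Alternation.

Section TopForm.
Variables (R : realType) (n : nat).

(** For a fixed index map f, the signed sum over permutations is the determinant of
    [frame R f *m V^T], so that [\det V] factors out. *)
Lemma alt_frame (F : kform R n n) V : multilinear F ->
  alt F V = \det V * \sum_(f : {ffun 'I_n -> 'I_n}) \det (frame R f) * F (frame R f).
Proof.
move=> mF; rewrite /alt; under eq_bigr => s _ do
  rewrite (multilinear_expand _ mF) big_distrr /=.
rewrite exchange_big big_distrr /=; apply: eq_bigr => f _.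
rewrite mulrA -[in \det V]det_tr [\det _ * \det _]mulrC -det_mulmx big_distrl /=.
apply: eq_bigr => s _; rewrite mulrA; congr (_ * _ * _).
apply: eq_bigr => r _; rewrite !mxE (bigD1 (f r)) //= !mxE eqxx mul1r big1 ?addr0 //.
by move=> j jf; rewrite !mxE eq_sym (negPf jf) mul0r.
Qed.

(** Top-degree forms are a line; hence pulling back a top-degree product multiplies its coefficient
    by a determinant. *)
Lemma alt_det (F : kform R n n) V : multilinear F ->
  alt F V = \det V * alt F 1%:M.
Proof. by move=> mF; rewrite !alt_frame // det1 mul1r. Qed.

End TopForm.

(** * The Hodge star and the inner product of forms *)

Section Hodge.
Variables (R : realType).

Definition fcat (I : finType) k l (f : {ffun 'I_k -> I}) (g : {ffun 'I_l -> I}) :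
    {ffun 'I_(k + l) -> I} :=
  [ffun i => match fintype.split i with inl j => f j | inr j => g j end].

Lemma fcatL (I : finType) k l (f : {ffun 'I_k -> I}) (g : {ffun 'I_l -> I}) i :
  fcat f g (lshift l i) = f i.
Proof. by rewrite ffunE (unsplitK (inl i)). Qed.

Lemma fcatR (I : finType) k l (f : {ffun 'I_k -> I}) (g : {ffun 'I_l -> I}) i :
  fcat f g (rshift k i) = g i.
Proof. by rewrite ffunE (unsplitK (inr i)). Qed.

Lemma sum_fcat (V : nmodType) (I : finType) k l
    (P : {ffun 'I_(k + l) -> I} -> V) :
  \sum_f P f = \sum_(f : {ffun 'I_k -> I}) \sum_(g : {ffun 'I_l -> I}) P (fcat f g).
Proof.
rewrite pair_big /= (reindex (fun p : {ffun 'I_k -> I} * {ffun 'I_l -> I} =>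
  fcat p.1 p.2)) //=.
exists (fun f => ([ffun i => f (lshift l i)], [ffun i => f (rshift k i)]))
  => [[f g] _|f _] /=.
  by congr pair; apply/ffunP => i; rewrite ffunE ?fcatL ?fcatR.
by apply/ffunP => i; rewrite -[i]splitK; case: (fintype.split i) => j /=;
  rewrite ?fcatL ?fcatR ffunE.
Qed.

Lemma frame_fcat n k l (f : {ffun 'I_k -> 'I_n}) (g : {ffun 'I_l -> 'I_n}) :
  frame R (fcat f g) = col_mx (frame R f) (frame R g).
Proof.
apply/matrixP => i j; rewrite -[i]splitK; case: (fintype.split i) => x /=.
  by rewrite col_mxEu !mxE fcatL.
by rewrite col_mxEd !mxE fcatR.
Qed.

Lemma multilinear_det n : multilinear (fun V : 'M[R]_n => \det V).
Proof. by move=> i b c U V W; exact: determinant_multilinear. Qed.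

(** Both sides are [\det (frame R f *m G)], on the left expanded along its rows. *)
Lemma det_frame_contract n (G : 'M[R]_n) (f : {ffun 'I_n -> 'I_n}) :
  \sum_(h : {ffun 'I_n -> 'I_n}) (\prod_r G (f r) (h r)) * \det (frame R h) =
  \det (frame R f) * \det G.
Proof.
rewrite -det_mulmx (multilinear_expand _ (@multilinear_det n)).
apply: eq_bigr => h _; congr (_ * _); apply: eq_bigr => r _.
rewrite mxE (bigD1 (f r)) //= !mxE eqxx mul1r big1 ?addr0 // => j jf.
by rewrite !mxE eq_sym (negPf jf) mul0r.
Qed.

(** Raising all indices of [vol] multiplies the alternating symbol by det(G^-1) det A = 1 / det A;
    what remains is the expansion of a /\ b on frames. *)
Lemma form_dot_hodge_star k l (A : 'M[R]_(k + l)) (vol : kform R (k + l) (k + l))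
    (a : kform R (k + l) k) (b : kform R (k + l) l) :
  A \in unitmx -> vol =1 pullback A (fun V : 'M[R]_(k + l) => \det V) ->
  multilinear a -> multilinear b ->
  form_dot (A *m A^T) (hodge_star (A *m A^T) vol a) b =
  wedge a b 1%:M / \det A.
Proof.
move=> uA volE ma mb; set Gi := invmx (A *m A^T).
have Gsym i j : Gi i j = Gi j i.
  have : Gi^T = Gi by rewrite /Gi trmx_inv trmx_mul trmxK.
  by move=> /matrixP /(_ j i); rewrite mxE.
have detA0 : \det A != 0 by rewrite -unitfE -unitmxE.
have detGi : \det Gi = (\det A ^+ 2)^-1.
  by rewrite /Gi det_inv det_mulmx det_tr.
rewrite wedge_alt alt_frame; last exact: multilinear_tens.
have fact0 p : p`!%:R != 0 :> R by rewrite pnatr_eq0 -lt0n fact_gt0.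
pose X (f h : {ffun 'I_k -> 'I_(k + l)}) (f' h' : {ffun 'I_l -> 'I_(k + l)}) :=
  (\prod_(r < k) Gi (f r) (h r)) *
  (\prod_(r < l) Gi (h' r) (f' r)) * \det (frame R (fcat h f')) * \det A *
  (a (frame R f) * b (frame R h')).
(* With the arguments f of a and h' of b fixed outside, the inner sums over h and f' contract the
   combined index maps [fcat f h'] and [fcat h f'], as in [det_frame_contract]. *)
transitivity ((k`! * l`!)%:R^-1 * \sum_f \sum_h' \sum_h \sum_f' X f h f' h').
  transitivity ((k`! * l`!)%:R^-1 * \sum_f' \sum_h' \sum_f \sum_h X f h f' h').
    rewrite /form_dot /hodge_star natrM invfM -!mulrA [RHS]mulrCA; congr (_ * _).
    rewrite [RHS]big_distrr /=; apply: eq_bigr => f' _.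
    rewrite [RHS]big_distrr /=; apply: eq_bigr => h' _.
    rewrite -[LHS]mulrA -[X in _ * X = _]mulrA [LHS]mulrCA; congr (_ * _).
    rewrite big_distrl big_distrr /=; apply: eq_bigr => f _.
    rewrite big_distrl big_distrr /=; apply: eq_bigr => h _.
    rewrite volE /pullback det_mulmx -frame_fcat /X.
    have -> : \prod_(r < l) Gi (f' r) (h' r) = \prod_(r < l) Gi (h' r) (f' r).
      by apply: eq_bigr => r _; exact: Gsym.
    by ring.
  congr (_ * _); rewrite exchange_big /=.
  under eq_bigr => h' _ do rewrite exchange_big /=.
  rewrite exchange_big /=.
  by do 2![apply: eq_bigr => ? _]; rewrite exchange_big.
rewrite -mulrA; congr (_ * _).
rewrite det1 mul1r sum_fcat big_distrl /=; apply: eq_bigr => f _.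
rewrite big_distrl /=; apply: eq_bigr => h' _.
have := det_frame_contract Gi (fcat f h'); rewrite detGi => /(congr1 ( *%R^~ (\det A))).
rewrite sum_fcat big_distrl /= => e.
transitivity (\det (frame R (fcat f h')) / \det A ^+ 2 * \det A *
  (a (frame R f) * b (frame R h'))); last first.
  rewrite /tens frame_fcat col_mxKu col_mxKd; field.
  exact: detA0.
rewrite -e big_distrl /=; apply: eq_bigr => h _.
rewrite !big_distrl /=; apply: eq_bigr => f' _.
rewrite /X big_split_ord /=; congr (_ * _ * _ * _ * _).
  by apply: eq_bigr => r _; rewrite !fcatL.
by apply: eq_bigr => r _; rewrite !fcatR.
Qed.

End Hodge.

(** * Top-degree forms in dimension 7 *)

Definition ord7 (k : nat) (lt_k7 : (k < 7)%N) : 'I_7 := Ordinal lt_k7.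
Local Notation "# k" := (@ord7 k isT) (at level 2).

Section IndexSums.
Variable R : realType.

Definition asum (P : ('I_7 -> 'I_7) -> R) : R := \sum_(s : 'S_7) (-1) ^+ s * P s.

Lemma asumD (P Q : ('I_7 -> 'I_7) -> R) : asum (fun f => P f + Q f) = asum P + asum Q.
Proof. by rewrite -big_split; apply: eq_bigr => s _; rewrite mulrDr. Qed.

Lemma asumN P : asum (fun f => - P f) = - asum P.
Proof. by rewrite -sumrN; apply: eq_bigr => s _; rewrite mulrN. Qed.

Lemma eq_asum (P Q : ('I_7 -> 'I_7) -> R) : (forall s : 'S_7, P s = Q s) -> asum P = asum Q.
Proof. by move=> PQ; apply: eq_bigr => s _; rewrite PQ. Qed.

(** The product [t * s] applies t first, so that the reindexing permutes the slots of P rather than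
    the values put into them. *)
Lemma asum_perm (t : 'S_7) (P Q : ('I_7 -> 'I_7) -> R) :
  (forall s : 'S_7, P (t * s)%g = Q s) -> asum Q = (-1) ^+ t * asum P.
Proof.
move=> PQ; rewrite /asum [in RHS](reindex_inj (mulgI t)) big_distrr /=.
apply: eq_bigr => s _; rewrite odd_permM signr_addb !mulrA -signr_addb addbb mul1r.
by rewrite PQ.
Qed.

Definition comp2 (b : kform R 7 2) (i j : 'I_7) : R :=
  b (frame R [ffun r : 'I_2 => nth i [:: i; j] r]).
Definition comp3 (a : kform R 7 3) (i j k : 'I_7) : R :=
  a (frame R [ffun r : 'I_3 => nth i [:: i; j; k] r]).
Definition comp1 (a : kform R 7 1) (i : 'I_7) : R := a (delta_mx 0 i).

Ltac rows := by
  congr (_ _); apply/matrixP => -[[|[|[|?]]] // ?] ?; rewrite !mxE ?ffunE /=;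
  congr ((_ == _)%:R); congr (_ _); apply/val_inj.

Lemma alt322E (a : kform R 7 3) (b c : kform R 7 2) :
  alt (tens (tens a b) c) 1%:M = asum (fun f =>
    comp3 a (f #0) (f #1) (f #2) * comp2 b (f #3) (f #4) * comp2 c (f #5) (f #6)).
Proof.
apply: eq_bigr => s _; rewrite /tens; congr (_ * (_ * _ * _)).
- rows.
- rows.
- rows.
Qed.

Lemma alt1222E (a : kform R 7 1) (b c d : kform R 7 2) :
  alt (tens (tens (tens a b) c) d) 1%:M = asum (fun f =>
    comp1 a (f #0) * comp2 b (f #1) (f #2) * comp2 c (f #3) (f #4) *
    comp2 d (f #5) (f #6)).
Proof.
apply: eq_bigr => s _; rewrite /tens; congr (_ * (_ * _ * _ * _)).
- congr (_ _); apply/matrixP => r c'; rewrite !mxE (ord1 r) eqxx eq_sym.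
  by congr ((_ == _)%:R); congr (_ _); apply/val_inj.
- rows.
- rows.
- rows.
Qed.

Lemma alt223E (a b : kform R 7 2) (c : kform R 7 3) :
  alt (tens (tens a b) c) 1%:M = asum (fun f =>
    comp2 a (f #0) (f #1) * comp2 b (f #2) (f #3) * comp3 c (f #4) (f #5) (f #6)).
Proof.
apply: eq_bigr => s _; rewrite /tens; congr (_ * (_ * _ * _)).
- rows.
- rows.
- rows.
Qed.

(** Exchanging two pairs of slots is an even permutation, so 2-forms commute. *)
Lemma alt322C (a : kform R 7 3) (b c : kform R 7 2) :
  alt (tens (tens a b) c) 1%:M = alt (tens (tens a c) b) 1%:M.
Proof.
rewrite !alt322E (asum_perm (t := tperm #3 #5 * tperm #4 #6) (Q := fun f =>
    comp3 a (f #0) (f #1) (f #2) * comp2 b (f #3) (f #4) * comp2 c (f #5) (f #6))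
  (P := fun f =>
    comp3 a (f #0) (f #1) (f #2) * comp2 c (f #3) (f #4) * comp2 b (f #5) (f #6))).
  by rewrite odd_mul_tperm odd_tperm /= mul1r.
by move=> s; rewrite !permM !permE /= mulrAC.
Qed.

(** The vector field v with v |_ vol = b /\ b /\ b up to a constant; [dvec] is
    the Leibniz rule for its divergence, the derivatives [db i j k] of b_jk
    along e_i being given. *)
Definition vec (b : 'I_7 -> 'I_7 -> R) (i : 'I_7) : R :=
  \sum_(s : 'S_7 | s #0 == i) (-1) ^+ s *
    (b (s #1) (s #2) * b (s #3) (s #4) * b (s #5) (s #6)).

Definition dvec (b : 'I_7 -> 'I_7 -> R) (db : 'I_7 -> 'I_7 -> 'I_7 -> R)
    (i : 'I_7) : R :=
  \sum_(s : 'S_7 | s #0 == i) (-1) ^+ s *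
    (db i (s #1) (s #2) * b (s #3) (s #4) * b (s #5) (s #6) +
     b (s #1) (s #2) * db i (s #3) (s #4) * b (s #5) (s #6) +
     b (s #1) (s #2) * b (s #3) (s #4) * db i (s #5) (s #6)).

(** Permutations are grouped by the index given to a. For a = df this identifies df /\ b /\ b /\ b
    with the derivative of f along the field [vec]. *)
Lemma alt_vec (a : kform R 7 1) (b : kform R 7 2) :
  alt (tens (tens (tens a b) b) b) 1%:M = \sum_i comp1 a i * vec (comp2 b) i.
Proof.
rewrite alt1222E /asum (partition_big (fun s : 'S_7 => s #0) predT) //=.
apply: eq_bigr => i _; rewrite /vec big_distrr; apply: eq_bigr => s /eqP <- /=.
by move: ((-1) ^+ _) => e; ring.
Qed.

(** Both sides are three times the same signed sum. On the left the three Leibniz terms agree after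
    even exchanges of index pairs; on the right the three terms of a agree after permuting slots 0,
    1, 2, the middle one by an odd swap that absorbs its minus sign. *)
Lemma sum_dvec (a : kform R 7 3) (b : kform R 7 2) db :
  (forall i j k, comp3 a i j k = db i j k - db j i k + db k i j) ->
  \sum_i dvec (comp2 b) db i = alt (tens (tens a b) b) 1%:M.
Proof.
move=> aE; set c := comp2 b.
pose P (f : 'I_7 -> 'I_7) :=
  db (f #0) (f #1) (f #2) * c (f #3) (f #4) * c (f #5) (f #6).
transitivity (asum P + asum P + asum P).
  transitivity (asum (fun f => P f +
      c (f #1) (f #2) * db (f #0) (f #3) (f #4) * c (f #5) (f #6) +
      c (f #1) (f #2) * c (f #3) (f #4) * db (f #0) (f #5) (f #6))).
    rewrite [RHS](partition_big (fun s : 'S_7 => s #0) predT) //=.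
    by apply: eq_bigr => i _; apply: eq_bigr => s /eqP <-.
  rewrite !asumD; congr (_ + _ + _).
    rewrite (asum_perm (t := tperm #1 #3 * tperm #2 #4) (P := P)).
      by rewrite odd_mul_tperm odd_tperm /= mul1r.
    by move=> s; rewrite /P !permM !permE /=; ring.
  rewrite (asum_perm (t := tperm #1 #5 * tperm #2 #6) (P := P)).
    by rewrite odd_mul_tperm odd_tperm /= mul1r.
  by move=> s; rewrite /P !permM !permE /=; ring.
rewrite alt322E [RHS](eq_asum (Q := fun f => P f +
  - (db (f #1) (f #0) (f #2) * c (f #3) (f #4) * c (f #5) (f #6)) +
  db (f #2) (f #0) (f #1) * c (f #3) (f #4) * c (f #5) (f #6))); last first.
  by move=> s /=; rewrite aE /P /c; ring.
rewrite !asumD asumN; congr (_ + _ + _).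
  rewrite (asum_perm (t := tperm #0 #1) (P := P) (Q := fun f =>
    db (f #1) (f #0) (f #2) * c (f #3) (f #4) * c (f #5) (f #6))).
    by rewrite odd_tperm /= expr1 mulN1r opprK.
  by move=> s; rewrite /P !permM !permE /=.
rewrite [RHS](asum_perm (t := tperm #0 #2 * tperm #0 #1) (P := P)).
  by rewrite odd_mul_tperm odd_tperm /= mul1r.
by move=> s; rewrite /P !permM !permE /=.
Qed.

End IndexSums.

(** An enumeration of the permutations, with their parities, that reduces by
    computation, as ['S_n] does not. *)
Fixpoint signed_perms (n : nat) : seq (bool * seq nat) :=
  if n is n'.+1 then
    [seq (odd i (+) t.1, i :: [seq bump i k | k <- t.2]) |
      i <- iota 0 n, t <- signed_perms n']
  else [:: (false, [::])].

Lemma signed_permsS n : signed_perms n.+1 =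
  [seq (odd i (+) t.1, i :: [seq bump i k | k <- t.2]) |
    i <- iota 0 n.+1, t <- signed_perms n].
Proof. by []. Qed.

(** Injectivity suffices, since (n + 1) n! = (n + 1)!. *)
Lemma lift_perm_pair_bij n :
  bijective (fun p : 'I_n.+1 * 'S_n => lift_perm ord0 p.1 p.2).
Proof.
apply: inj_card_bij; last by rewrite card_prod card_ord !card_Sn factS.
move=> [i s] [j t] /= e; have /= ij := congr1 (fun u : 'S_n.+1 => u ord0) e.
rewrite !lift_perm_id in ij; rewrite -ij in e *; congr pair; apply/permP => k.
have /= := congr1 (fun u : 'S_n.+1 => u (lift ord0 k)) e.
by rewrite !lift_perm_lift => /lift_inj.
Qed.

(** Permutations are split by the image i of 0: it contributes the sign (-1)^i, and [bump i]
    renumbers the values of the rest. *)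
Lemma sum_signed_perms (R : comNzRingType) n (F : seq nat -> R) :
  \sum_(s : 'S_n) (-1) ^+ s * F [seq val (s i) | i <- enum 'I_n] =
  \sum_(t <- signed_perms n) (-1) ^+ t.1 * F t.2.
Proof.
elim: n F => [|n IH] F.
  rewrite /= big_seq1 (big_pred1 1%g) => [|s]; last first.
    by apply/esym/eqP/permP => -[].
  by rewrite odd_perm1 /= (_ : enum 'I_0 = [::]) //; apply/size0nil; rewrite size_enum_ord.
rewrite signed_permsS; move: (signed_perms n) IH => L IH.
rewrite (reindex _ (onW_bij _ (lift_perm_pair_bij n))).
rewrite big_allpairs_dep -(val_enum_ord n.+1) big_map big_enum /=.
rewrite -(pair_bigA _ (fun i t => (-1) ^+ lift_perm ord0 i t *
  F [seq val (lift_perm ord0 i t k) | k <- enum 'I_n.+1])) /=.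
apply: eq_bigr => i _.
under [RHS]eq_bigr => t _ do rewrite /= signr_addb -mulrA mulrCA.
rewrite -(IH (fun l => (-1) ^+ odd i * F (val i :: [seq bump i k | k <- l]))).
apply: eq_bigr => s _; rewrite odd_lift_perm /= signr_addb mulrCA -mulrA.
congr (_ * (_ * F _)); rewrite enum_ordSl /= lift_perm_id -!map_comp.
by congr (_ :: _); apply: eq_map => k /=; rewrite lift_perm_lift.
Qed.

Definition contract2 (R : realType) (a : kform R 7 3) (u : 'rV[R]_7) : kform R 7 2 :=
  fun V => a (mx_cons u V).

(** Bryant's symmetric form (u |_ phi) /\ (v |_ phi) /\ phi, which is a constant
    multiple of g_phi(u, v) vol. *)
Definition bryant (R : realType) (a : kform R 7 3) (u v : 'rV[R]_7) : R :=
  alt (tens (tens (contract2 a u) (contract2 a v)) a) 1%:M.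

(** * Evaluation of Bryant's form on phi0 *)

Section Phi0.

(** The coefficients of dx^(abc) and of phi0, with indices counted from 0. *)
Definition dxz (a b c i j k : nat) : int :=
  if i == a then ((j == b) && (k == c))%:Z - ((j == c) && (k == b))%:Z
  else if i == b then ((j == c) && (k == a))%:Z - ((j == a) && (k == c))%:Z
  else if i == c then ((j == a) && (k == b))%:Z - ((j == b) && (k == a))%:Z
  else 0.

Definition phi0z (i j k : nat) : int :=
  dxz 0 1 2 i j k - dxz 0 5 6 i j k - dxz 4 1 6 i j k - dxz 4 5 2 i j k +
  dxz 3 0 4 i j k + dxz 3 1 5 i j k + dxz 3 2 6 i j k.

(** This is [bryant] of phi0 on e_u and e_v in integers. The early tests for zero discard most of
    the 5040 permutations, which keeps the evaluation cheap. *)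
Definition phi0_sum (u v : nat) : int :=
  foldr +%R 0 [seq
    let z1 := phi0z u (nth 0%N t.2 0) (nth 0%N t.2 1) in
    if z1 == 0 then 0 else
    let z2 := phi0z v (nth 0%N t.2 2) (nth 0%N t.2 3) in
    if z2 == 0 then 0 else
    let z := z1 * z2 * phi0z (nth 0%N t.2 4) (nth 0%N t.2 5) (nth 0%N t.2 6) in
    if t.1 then - z else z | t <- signed_perms 7].

(** Bryant's form of phi0 is 6 g vol, and 144 = 6 * 2! 2! 3!, the factorials being the normalisation
    that [alt] omits. *)
Lemma phi0_sumE (u v : 'I_7) : phi0_sum u v = if u == v then 144 else 0.
Proof.
have : all (fun u => all (fun v =>
    phi0_sum u v == if u == v then 144 else 0) (iota 0 7)) (iota 0 7).
  by vm_compute.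
move=> /allP /(_ u); rewrite mem_iota ltn_ord => /(_ isT).
by move=> /allP /(_ v); rewrite mem_iota ltn_ord => /(_ isT) /eqP.
Qed.

Variable R : realType.

Lemma det3 (A : 'M[R]_3) (i0 := @Ordinal 3 0 isT) (i1 := @Ordinal 3 1 isT)
    (i2 := @Ordinal 3 2 isT) :
  \det A = A i0 i0 * (A i1 i1 * A i2 i2 - A i1 i2 * A i2 i1) +
           A i0 i1 * (A i1 i2 * A i2 i0 - A i1 i0 * A i2 i2) +
           A i0 i2 * (A i1 i0 * A i2 i1 - A i1 i1 * A i2 i0).
Proof.
have E : enum 'I_3 = [:: i0; i1; i2].
  by apply: (inj_map val_inj); rewrite val_enum_ord.
pose F (l : seq nat) := A i0 (inord (nth 0%N l 0)) *
  A i1 (inord (nth 0%N l 1)) * A i2 (inord (nth 0%N l 2)).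
transitivity (\sum_(s : 'S_3) (-1) ^+ s * F [seq val (s i) | i <- enum 'I_3]).
  apply: eq_bigr => s _; congr (_ * _).
  by rewrite /F E /= !inord_val -big_enum /= E !big_cons big_nil mulr1 mulrA.
rewrite sum_signed_perms /signed_perms /= /F; rewrite !big_cons big_nil /=.
have -> : inord 0 = i0 by apply/val_inj; rewrite /= inordK.
have -> : inord 1 = i1 by apply/val_inj; rewrite /= inordK.
have -> : inord 2 = i2 by apply/val_inj; rewrite /= inordK.
by rewrite /= !expr0 !expr1; ring.
Qed.

Lemma comp3_dx3 (a b c : nat) (i j k : 'I_7) :
  (a < 7)%N -> (b < 7)%N -> (c < 7)%N -> a != b -> a != c -> b != c ->
  comp3 (@dx3 R a.+1 b.+1 c.+1) i j k = (dxz a b c i j k)%:~R.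
Proof.
move=> a7 b7 c7 ab ac bc; rewrite /comp3 /dx3 det3 !mxE /= !ffunE /=.
have eI (x : 'I_7) d : (d < 7)%N -> (x == inord d) = (val x == d).
  by move=> d7; rewrite -val_eqE /= inordK.
rewrite !eI // /dxz.
have andE (x y : bool) : ((x && y)%:Z)%:~R = x%:R * y%:R :> R.
  by case: x; case: y; rewrite ?mulr0 ?mulr1.
have ex x y : x != y -> (val i == x) && (val i == y) = false.
  by move=> xy; apply/negP => /andP[/eqP -> /eqP e]; rewrite e eqxx in xy.
move: (ex _ _ ab) (ex _ _ ac) (ex _ _ bc).
case: (val i == a); case: (val i == b); case: (val i == c) => //= _ _ _;
  by rewrite ?rmorphB /= ?andE !(mul1r, mul0r, addr0, add0r).
Qed.

Lemma comp3_phi0 (i j k : 'I_7) : comp3 (@phi0 R) i j k = (phi0z i j k)%:~R.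
Proof.
by rewrite /phi0z !(rmorphD, rmorphN) /= -!comp3_dx3.
Qed.

Lemma multilinear_dx3 a b c : multilinear (@dx3 R a b c).
Proof.
move=> i x y U V W UE VE WE; apply: (@multilinear_det _ _ i).
- apply/rowP => j; have /rowP := UE.
  by move=> /(_ (inord (nth 0%N [:: a; b; c] j).-1)); rewrite !mxE.
- apply/matrixP => r s; have /matrixP := VE.
  by move=> /(_ r (inord (nth 0%N [:: a; b; c] s).-1)); rewrite !mxE.
- apply/matrixP => r s; have /matrixP := WE.
  by move=> /(_ r (inord (nth 0%N [:: a; b; c] s).-1)); rewrite !mxE.
Qed.

Lemma multilinear_phi0 : multilinear (@phi0 R).
Proof.
move=> i x y U V W UE VE WE; rewrite /phi0.
by rewrite !(multilinear_dx3 _ _ _ UE VE WE); ring.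
Qed.

Lemma comp2_contract2 (a : kform R 7 3) (u i j : 'I_7) :
  comp2 (contract2 a (delta_mx 0 u)) i j = comp3 a u i j.
Proof.
rewrite /comp2 /contract2 /comp3; congr (a _); apply/matrixP => r c; rewrite !mxE ffunE.
case: unliftP => [r' ->|->]; rewrite ?mxE ?ffunE /=; last by rewrite eq_sym.
by case: r' => [[|[|]]].
Qed.

Lemma bryant_phi0_delta (u v : 'I_7) :
  bryant (@phi0 R) (delta_mx 0 u) (delta_mx 0 v) = 144 * (u == v)%:R.
Proof.
rewrite /bryant alt223E.
pose F (l : seq nat) : R := (phi0z u (nth 0%N l 0) (nth 0%N l 1) *
  phi0z v (nth 0%N l 2) (nth 0%N l 3) *
  phi0z (nth 0%N l 4) (nth 0%N l 5) (nth 0%N l 6))%:~R.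
transitivity (\sum_(s : 'S_7) (-1) ^+ s * F [seq val (s i) | i <- enum 'I_7]).
  apply: eq_bigr => s _; congr (_ * _); rewrite !comp2_contract2 !comp3_phi0 /F.
  have nthE k (k7 : (k < 7)%N) : nth 0%N [seq val (s i) | i <- enum 'I_7] k = s (ord7 k7).
    by rewrite (nth_map (ord7 k7)) ?size_enum_ord // (nth_ord_enum _ (ord7 k7)).
  by rewrite !rmorphM /= (nthE 0%N isT) (nthE 1%N isT) (nthE 2%N isT) (nthE 3%N isT)
    (nthE 4%N isT) (nthE 5%N isT) (nthE 6%N isT).
rewrite sum_signed_perms.
transitivity ((phi0_sum u v)%:~R : R); last first.
  by rewrite phi0_sumE; case: eqP => _; rewrite ?mulr1 ?mulr0.
(* The list is made opaque, lest simplification unfold its 5040 entries; from here on the identity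
   holds for any list. *)
rewrite /phi0_sum; move: (signed_perms 7) => L; rewrite foldrE big_map rmorph_sum /=.
apply: eq_bigr => t _.
rewrite /F; case: eqP => [->|_]; first by rewrite !mul0r mulr0.
case: eqP => [->|_]; first by rewrite mulr0 mul0r mulr0.
by case: t.1; rewrite ?rmorphN /= ?expr0 ?expr1 ?mul1r ?mulN1r.
Qed.

End Phi0.

(** * The algebra of G2 *)

Section Pullback.
Variables (R : realType) (n : nat).

Lemma multilinear_row_perm k (a : kform R n k) (s : 'S_k) :
  multilinear a -> multilinear (fun V => a (row_perm s V)).
Proof.
have rowE (U : 'M[R]_(k, n)) i : row ((s^-1)%g i) (row_perm s U) = row i U.
  by apply/rowP => j; rewrite !mxE permKV.
have row'E (U V : 'M[R]_(k, n)) i : row' i U = row' i V ->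
    row' ((s^-1)%g i) (row_perm s U) = row' ((s^-1)%g i) (row_perm s V).
  move=> /matrixP UV; apply/matrixP => x y; rewrite !mxE.
  case: (unliftP i (s (lift ((s^-1)%g i) x))) => [z ->|e].
    by have := UV z y; rewrite !mxE.
  by have := neq_lift ((s^-1)%g i) x; rewrite -[X in _ != X](permK s) e eqxx.
move=> ma i b c U V W UE VE WE; apply: (ma ((s^-1)%g i)).
- by rewrite !rowE.
- exact: row'E.
- exact: row'E.
Qed.

Lemma multilinear_alt k (a : kform R n k) : multilinear a -> multilinear (alt a).
Proof.
move=> ma i b c U V W UE VE WE; rewrite /alt !big_distrr -big_split /=.
by apply: eq_bigr => s _; have /= -> := multilinear_row_perm s ma UE VE WE;
  rewrite mulrDr; congr (_ + _); exact: mulrCA.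
Qed.

Lemma multilinear_wedge k l (a : kform R n k) (b : kform R n l) :
  multilinear a -> multilinear b -> multilinear (wedge a b).
Proof.
move=> ma mb i c d U V W UE VE WE; rewrite !wedge_alt.
by have -> := multilinear_alt (multilinear_tens ma mb) UE VE WE; ring.
Qed.

Lemma usub_mulmx m1 m2 p (V : 'M[R]_(m1 + m2, n)) (A : 'M[R]_(n, p)) :
  usubmx (V *m A) = usubmx V *m A.
Proof. by apply/matrixP => i j; rewrite !mxE; apply: eq_bigr => k _; rewrite !mxE. Qed.

Lemma dsub_mulmx m1 m2 p (V : 'M[R]_(m1 + m2, n)) (A : 'M[R]_(n, p)) :
  dsubmx (V *m A) = dsubmx V *m A.
Proof. by apply/matrixP => i j; rewrite !mxE; apply: eq_bigr => k _; rewrite !mxE. Qed.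

Lemma alt_pullback k (A : 'M[R]_n) (a : kform R n k) V :
  alt (fun V => a (V *m A)) V = alt a (V *m A).
Proof. by apply: eq_bigr => s _; rewrite row_perm_mulmx. Qed.

Lemma multilinear_pullback k (A : 'M[R]_n) (a : kform R n k) :
  multilinear a -> multilinear (pullback A a).
Proof.
move=> ma i b c U V W UE VE WE; apply: (ma i).
- by rewrite !row_mul UE mulmxDl !scalemxAl.
- by rewrite !row'Esub -!mul_rowsub_mx -!row'Esub VE.
- by rewrite !row'Esub -!mul_rowsub_mx -!row'Esub WE.
Qed.

End Pullback.

Section G2Algebra.
Variable R : realType.
Implicit Types (a : kform R 7 3) (b c : kform R 7 2) (A : 'M[R]_7).

(** Constant multiples of a /\ b /\ c and t /\ b /\ b /\ b, as multiples of the
    standard volume form. *)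
Definition top322 a b c : R := alt (tens (tens a b) c) 1%:M.
Definition top1222 (t : kform R 7 1) b : R :=
  alt (tens (tens (tens t b) b) b) 1%:M.

Lemma top322_pullback A a b c : multilinear a -> multilinear b -> multilinear c ->
  top322 (pullback A a) (pullback A b) (pullback A c) = \det A * top322 a b c.
Proof.
move=> ma mb mc; rewrite /top322 -alt_det; last first.
  exact: (multilinear_tens (multilinear_tens ma mb) mc).
rewrite -[A in RHS]mul1mx -alt_pullback; apply: eq_alt => V.
by rewrite /tens /pullback !(usub_mulmx, dsub_mulmx).
Qed.

Lemma top1222_pullback A (t : kform R 7 1) b : multilinear t -> multilinear b ->
  top1222 (pullback A t) (pullback A b) = \det A * top1222 t b.
Proof.
move=> mt mb; rewrite /top1222 -alt_det; last first.
  exact: (multilinear_tens (multilinear_tens (multilinear_tens mt mb) mb) mb).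
rewrite -[A in RHS]mul1mx -alt_pullback; apply: eq_alt => V.
by rewrite /tens /pullback !(usub_mulmx, dsub_mulmx).
Qed.

Lemma multilinear_contract2 a u : multilinear a -> multilinear (contract2 a u).
Proof. exact: multilinear_cons. Qed.

Lemma mx_cons_mulmx k (u : 'rV[R]_7) (V : 'M[R]_(k, 7)) A :
  mx_cons u V *m A = mx_cons (u *m A) (V *m A).
Proof.
apply/matrixP => i j; case: (unliftP ord0 i) => [i'|] ->; rewrite !mxE;
by rewrite ?liftK ?unlift_none ?mxE; apply: eq_bigr => s _;
  rewrite !mxE ?liftK ?unlift_none.
Qed.

Lemma bryant_pullback a A u v : multilinear a ->
  bryant (pullback A a) u v = \det A * bryant a (u *m A) (v *m A).
Proof.
move=> ma; rewrite /bryant -alt_det; last first.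
  have mc w : multilinear (contract2 a w) by exact: multilinear_contract2.
  exact: (multilinear_tens (multilinear_tens (mc _) (mc _)) ma).
rewrite -[A in RHS]mul1mx -alt_pullback; apply: eq_alt => V.
by rewrite /tens /contract2 /pullback !(usub_mulmx, dsub_mulmx) !mx_cons_mulmx mul1mx.
Qed.

Lemma bryant_expand a u v : multilinear a ->
  bryant a u v =
  \sum_i \sum_j u 0 i * v 0 j * bryant a (delta_mx 0 i) (delta_mx 0 j).
Proof.
move=> ma; rewrite /bryant /alt.
rewrite (eq_bigr (fun s : 'S_7 => \sum_i \sum_j u 0 i * v 0 j * ((-1) ^+ s *
    tens (tens (contract2 a (delta_mx 0 i)) (contract2 a (delta_mx 0 j))) a
      (row_perm s 1%:M)))).
  rewrite exchange_big /=; apply: eq_bigr => i _.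
  rewrite exchange_big /=; apply: eq_bigr => j _.
  by rewrite -big_distrr.
move=> s _; have cE w W : contract2 a w W =
    \sum_j w 0 j * contract2 a (delta_mx 0 j) W by exact: multilinear_row0.
rewrite /tens (cE u) (cE v) -mulrA big_distrl big_distrr /=.
apply: eq_bigr => i _; rewrite big_distrl big_distrr big_distrr /=.
by apply: eq_bigr => j _; move: ((-1) ^+ s) => e; ring.
Qed.

Definition bryant_mx a : 'M[R]_7 :=
  \matrix_(i, j) bryant a (delta_mx 0 i) (delta_mx 0 j).

(** Hence phi alone determines \det A, that is, the oriented volume, as a ninth
    root of a polynomial in the coefficients of phi. *)
Lemma det_bryant_mx A a : a =1 pullback A (@phi0 R) ->
  \det (bryant_mx a) = 144 ^+ 7 * \det A ^+ 9.
Proof.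
move=> /funext ->.
(* The scalar det A enters a 7 x 7 determinant seven times and A A^T adds two more, whence the ninth
   power. *)
have -> : bryant_mx (pullback A (@phi0 R)) = (144 * \det A) *: (A *m A^T).
  apply/matrixP => i j; rewrite !mxE bryant_pullback; last exact: multilinear_phi0.
  rewrite bryant_expand; last exact: multilinear_phi0.
  rewrite [144 * _]mulrC -[RHS]mulrA; congr (_ * _); rewrite big_distrr /=.
  apply: eq_bigr => k _; rewrite (bigD1 k) //= big1 ?addr0; last first.
    by move=> l lk; rewrite bryant_phi0_delta eq_sym (negPf lk) !mulr0.
  by rewrite bryant_phi0_delta eqxx mulr1 -!rowE !mxE; ring.
by rewrite detZ det_mulmx det_tr exprMn -mulrA -expr2 -exprD.
Qed.

Lemma wedge3_top322 a b c :
  wedge (wedge a b) c 1%:M = 24^-1 * top322 a b c.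
Proof. by rewrite wedge3_alt. Qed.

Lemma top322_symm a b c : top322 a b c = top322 a c b.
Proof. exact: alt322C. Qed.

Lemma top322D a b b' : top322 a (fun V => b V + b' V) (fun V => b V + b' V) =
  top322 a b b + top322 a b' b' + 2 * top322 a b b'.
Proof.
rewrite mulr_natl mulr2n [X in _ + (X + _)]top322_symm /top322 -!altD.
by apply: eq_alt => V; rewrite /tens; ring.
Qed.

Lemma form_dotZl G k r (a b : kform R 7 k) :
  form_dot G (fun V => r * a V) b = r * form_dot G a b.
Proof.
rewrite /form_dot mulrCA; congr (_ * _); rewrite big_distrr /=.
apply: eq_bigr => f _; rewrite big_distrr /=; apply: eq_bigr => h _; ring.
Qed.

Lemma form_dotC (G : 'M[R]_7) k (a b : kform R 7 k) :
  G^T = G -> form_dot G a b = form_dot G b a.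
Proof.
move=> GT; rewrite /form_dot; congr (_ * _); rewrite exchange_big /=.
apply: eq_bigr => f _; apply: eq_bigr => h _; rewrite mulrAC; congr (_ * _ * _).
apply: eq_bigr => r _.
have : (invmx G)^T = invmx G by rewrite trmx_inv GT.
by move=> /matrixP /(_ (f r) (h r)); rewrite mxE.
Qed.

Section Pointwise.
Variables (phi : kform R 7 3) (A : 'M[R]_7) (vol : kform R 7 7).
Hypotheses (uA : A \in unitmx) (phiE : phi =1 pullback A (@phi0 R))
  (volE : vol =1 pullback A (fun V : 'M[R]_7 => \det V)).
Let G := A *m A^T.

Lemma multilinear_phi : multilinear phi.
Proof.
by have -> : phi = pullback A (@phi0 R) by [exact/funext|];
  apply: multilinear_pullback; exact: multilinear_phi0.
Qed.

(** Replace r b by *(phi /\ b) and apply [form_dot_hodge_star]. *)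
Lemma form_dot_eigen (r : R) b c : multilinear b -> multilinear c ->
  (forall V, star_phi_wedge phi G vol b V = r * b V) ->
  r * form_dot G b c = top322 phi b c / (24 * \det A).
Proof.
move=> mb mc /funext bE; rewrite -form_dotZl -bE /star_phi_wedge.
rewrite (@form_dot_hodge_star R 5 2 A vol _ _ uA volE _ mc); last first.
  exact: multilinear_wedge multilinear_phi mb.
by rewrite wedge3_top322 invfM; ring.
Qed.

Lemma form_norm2_Lambda2_7 b : Lambda2_7 phi G vol b ->
  form_norm2 G b = top322 phi b b / (48 * \det A).
Proof.
move=> [[mb _] bE]; have := form_dot_eigen mb mb bE.
have A0 : \det A != 0 by rewrite -unitfE -unitmxE.
rewrite /form_norm2 => e; apply: (@mulfI _ 2); first by rewrite pnatr_eq0.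
by rewrite e; field; exact: A0.
Qed.

Lemma form_norm2_Lambda2_14 b : Lambda2_14 phi G vol b ->
  form_norm2 G b = - top322 phi b b / (24 * \det A).
Proof.
move=> [[mb _] bE]; have := @form_dot_eigen (-1) b b mb mb.
have A0 : \det A != 0 by rewrite -unitfE -unitmxE.
rewrite /form_norm2 => e; apply: (@mulfI _ (-1)); first by rewrite oppr_eq0 oner_eq0.
by rewrite e => [|V]; rewrite ?mulN1r //; field; exact: A0.
Qed.

(** Up to one common factor, the symmetric number phi /\ b7 /\ b14 is both 2 <b7, b14> and - <b14,
    b7>. So it vanishes, and only the diagonal terms of the square remain. *)
Lemma top322_split b7 b14 : Lambda2_7 phi G vol b7 -> Lambda2_14 phi G vol b14 ->
  top322 phi (fun V => b7 V + b14 V) (fun V => b7 V + b14 V) / (24 * \det A) =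
  2 * form_norm2 G b7 - form_norm2 G b14.
Proof.
move=> h7 h14.
have A0 : \det A != 0 by rewrite -unitfE -unitmxE.
rewrite (form_norm2_Lambda2_7 h7) (form_norm2_Lambda2_14 h14).
case: h7 h14 => [[m7 _] e7] [[m14 _] e14].
have GT : G^T = G by rewrite /G trmx_mul trmxK.
have x := form_dot_eigen m7 m14 e7.
have y : -1 * form_dot G b14 b7 = top322 phi b14 b7 / (24 * \det A).
  by apply: form_dot_eigen => // V; rewrite e14 mulN1r.
rewrite form_dotC // top322_symm -x in y.
have z : form_dot G b7 b14 = 0 by lra.
rewrite top322D; suff -> : top322 phi b7 b14 = 0 by field; exact: A0.
move: x; rewrite z mulr0 => /esym /eqP; rewrite mulf_eq0 invr_eq0 mulf_eq0.
by rewrite (negPf A0) pnatr_eq0 !orbF => /eqP.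
Qed.

End Pointwise.
End G2Algebra.

(** * Integration of derivatives over R^7 *)

Section Integration.
Variable R : realType.
Local Notation leb := (@lebesgue_measure R).

Lemma measurable_fun_open d (T : measurableType d) (f : T -> R) :
  (forall U : set R, open U -> measurable (f @^-1` U)) ->
  measurable_fun setT f.
Proof.
move=> mf; apply: (measurability _ (measurable_realfun.RGenOpens.measurableE R)).
by move=> _ [_ [a [b ->] <-]]; rewrite setTI; apply: mf; exact: interval_open.
Qed.

Lemma rV_open_rational n (U : set 'rV[R]_n) (x : 'rV[R]_n) : open U -> U x ->
  exists (q : 'rV[rat]_n) (k : nat),
    (forall i, `|x 0 i - ratr (q 0 i)| < k.+1%:R^-1) /\
    [set y : 'rV[R]_n | forall i, `|y 0 i - ratr (q 0 i)| < k.+1%:R^-1] `<=` U.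
Proof.
move=> oU Ux; have : nbhs x U by exact: open_nbhs_nbhs.
move=> /nbhs_ballP[e /= e0 xeU].
(* Half of e is required because x and y are each within 1/(k+1) of the rational centre. *)
have [k _ /(_ k (leqnn k)) ke] := near_infty_natSinv_lt (PosNum (divr_gt0 e0 (ltr0n R 2))).
have qP i : {q : rat | `|x 0 i - ratr q| < k.+1%:R^-1}.
  apply: cid; have /rat_in_itvoo[q] :
    x 0 i - k.+1%:R^-1 < x 0 i + k.+1%:R^-1.
    by rewrite ltrD2l gtrN // invr_gt0 ltr0n.
  rewrite in_itv /= => /andP[]; set r := k.+1%:R^-1 => q1 q2.
  by exists q; rewrite ltr_norml; apply/andP; split; lra.
exists (\row_i sval (qP i)), k; split=> [i|y yq].
  by rewrite mxE; exact: svalP (qP i).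
apply: xeU; split => // a i; rewrite (ord1 a).
have xq := svalP (qP i); have := yq i; rewrite mxE => {}yq.
rewrite /ball /= (le_lt_trans (ler_distD (ratr (sval (qP i))) _ _)) //.
rewrite [ltRHS]splitr ltrD // ?(lt_trans xq ke) // distrC.
exact: lt_trans yq ke.
Qed.

Lemma measurable_coord7 (i : 'I_7) :
  measurable_fun setT (fun t : R7 R => row7 t 0 i).
Proof.
have fstP d (T : measurableType d) (f : T -> R) :
    measurable_fun setT f -> measurable_fun setT (fun t : T * R => f t.1).
  by move=> mf; apply: (measurableT_comp mf); exact: measurable_fst.
have sndP d (T : measurableType d) : measurable_fun setT (fun t : T * R => t.2).
  exact: measurable_snd.
have row7E (f : R7 R -> R) : (forall t, row7 t 0 i = f t) -> measurable_fun setT f ->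
    measurable_fun setT (fun t : R7 R => row7 t 0 i).
  by move=> rE; rewrite (_ : (fun t => _) = f) //; apply/funext.
case: i row7E => [[|[|[|[|[|[|[|k]]]]]]] i7] row7E //.
- apply: (row7E (fun t => t.1.1.1.1.1.1)); last first.
    exact: (fstP _ _ _ (fstP _ _ _ (fstP _ _ _ (fstP _ _ _ (fstP _ _ _
      (@measurable_fst _ _ R R)))))).
  by move=> [[[[[[? ?] ?] ?] ?] ?] ?]; rewrite mxE.
- apply: (row7E (fun t => t.1.1.1.1.1.2)); last first.
    exact: (fstP _ _ _ (fstP _ _ _ (fstP _ _ _ (fstP _ _ _ (fstP _ _ _ (sndP _ _)))))).
  by move=> [[[[[[? ?] ?] ?] ?] ?] ?]; rewrite mxE.
- apply: (row7E (fun t => t.1.1.1.1.2)); last first.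
    exact: (fstP _ _ _ (fstP _ _ _ (fstP _ _ _ (fstP _ _ _ (sndP _ _))))).
  by move=> [[[[[[? ?] ?] ?] ?] ?] ?]; rewrite mxE.
- apply: (row7E (fun t => t.1.1.1.2)); last first.
    exact: (fstP _ _ _ (fstP _ _ _ (fstP _ _ _ (sndP _ _)))).
  by move=> [[[[[[? ?] ?] ?] ?] ?] ?]; rewrite mxE.
- apply: (row7E (fun t => t.1.1.2)); last first.
    exact: (fstP _ _ _ (fstP _ _ _ (sndP _ _))).
  by move=> [[[[[[? ?] ?] ?] ?] ?] ?]; rewrite mxE.
- apply: (row7E (fun t => t.1.2)); last first.
    exact: (fstP _ _ _ (sndP _ _)).
  by move=> [[[[[[? ?] ?] ?] ?] ?] ?]; rewrite mxE.
- apply: (row7E (fun t => t.2)); last exact: sndP.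
  by move=> [[[[[[? ?] ?] ?] ?] ?] ?]; rewrite mxE.
Qed.

(** The sigma-algebra of [R7] is a product one, whereas U is open for the topology of row vectors; U
    is the countable union of the rational boxes inside it, and each box is given by coordinate
    conditions. *)
Lemma measurable_row7_open (U : set 'rV[R]_7) : open U ->
  measurable (@row7 R @^-1` U).
Proof.
move=> oU.
pose box (p : 'rV[rat]_7 * nat) : set 'rV[R]_7 :=
  [set y | forall i, `|y 0 i - ratr (p.1 0 i)| < p.2.+1%:R^-1].
have -> : @row7 R @^-1` U =
    \bigcup_p (if pselect (box p `<=` U) then @row7 R @^-1` box p else set0).
  apply/seteqP; split => [t /(rV_open_rational oU)[q [k [qk qU]]]|t [p _]].
    by exists (q, k) => //; case: pselect.
  by case: pselect => // pU; exact: pU.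
apply: countable_bigcupT_measurable => [|p]; first exact: countableP.
case: pselect => [pU|npU]; last exact: measurable0.
rewrite /=; have -> : @row7 R @^-1` box p = \bigcap_(i in [set: 'I_7])
    ((fun t : R7 R => row7 t 0 i) @^-1` ball (ratr (p.1 0 i) : R) p.2.+1%:R^-1).
  apply/seteqP; split => [t tp i _|t tp i]; rewrite /ball /= distrC.
    exact: tp.
  by have := tp i I; rewrite /ball /=.
apply: fin_bigcap_measurable => [|i _]; first exact: finite_finset.
rewrite -[X in measurable X]setTI; apply: measurable_coord7 => //.
by apply: open_measurable; exact: ball_open.
Qed.

Lemma measurable_row7_continuous (h : 'rV[R]_7 -> R) :
  continuous h -> measurable_fun setT (h \o @row7 R).
Proof.
move=> ch; apply: measurable_fun_open => U oU; rewrite comp_preimage.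
by apply: measurable_row7_open; apply: open_comp => // x _; exact: ch.
Qed.

Lemma integral_prod_last d (T : measurableType d)
    (m : {sigma_finite_measure set T -> \bar R}) (f : T * R -> \bar R) :
  (m \x leb)%E.-integrable setT f ->
  (forall x, \int[leb]_y f (x, y) = 0)%E -> (\int[(m \x leb)%E]_z f z = 0)%E.
Proof.
by move=> intf f0; rewrite -integral12_prod_meas1 //; apply: integral0_eq => x _; exact: f0.
Qed.

Lemma integral_prod_first d (T : measurableType d)
    (m : {sigma_finite_measure set T -> \bar R}) (f : T * R -> \bar R) :
  (m \x leb)%E.-integrable setT f ->
  (forall y, \int[m]_x f (x, y) = 0)%E -> (\int[(m \x leb)%E]_z f z = 0)%E.
Proof.
by move=> intf f0; rewrite -integral21_prod_meas1 //; apply: integral0_eq => x _; exact: f0.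
Qed.

End Integration.

(** * Fubini and the fundamental theorem of calculus for compactly supported functions *)

Section Stokes.
Variable R : realType.
Local Notation leb := (@lebesgue_measure R).

Definition finite_on d (T : measurableType d) (m : set T -> \bar R) (B : set T) :=
  measurable B /\ (m B < +oo)%E.

(** A class of integrands that passes to every slice; a slice of a merely integrable function is
    integrable only almost everywhere. *)
Definition bounded_on d (T : measurableType d) (B : set T) (f : T -> R) :=
  [/\ measurable_fun setT f, exists K, forall x, `|f x| <= K &
      forall x, ~ B x -> f x = 0].

Lemma bounded_on_integrable d (T : measurableType d)
    (m : {measure set T -> \bar R}) B f :
  finite_on m B -> bounded_on B f -> m.-integrable setT (EFin \o f).
Proof.
move=> [mB finB] [mf [K fK] f0].
have -> : EFin \o f = (EFin \o f) \_ B.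
  apply/funext => x; rewrite patchE; case: ifPn => // /negP xB /=.
  by rewrite f0 // => Bx; apply: xB; rewrite inE.
apply/(integrable_mkcond _ mB); apply: measurable_bounded_integrable => //.
  exact: measurable_funTS.
exists K; split; first exact: num_real.
by move=> r Kr x _; rewrite /= (le_trans (fK x)) // ltW.
Qed.

Lemma bounded_on_slice1 d (T : measurableType d) (B : set T) (I : set R)
    (f : T * R -> R) y :
  bounded_on (B `*` I) f -> bounded_on B (fun x => f (x, y)).
Proof.
move=> [mf [K fK] f0]; split.
- by apply: (measurableT_comp mf); apply: measurable_fun_pair.
- by exists K => x; exact: fK.
- by move=> x nBx; apply: f0 => -[].
Qed.

Lemma sigma_finite_product d1 d2 (T1 : measurableType d1) (T2 : measurableType d2)
    (m1 : {sigma_finite_measure set T1 -> \bar R})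
    (m2 : {sigma_finite_measure set T2 -> \bar R}) :
  sigma_finite setT (m1 \x m2)%E.
Proof.
have /sigma_finiteP[F [TF incF finF]] := sigma_finiteT m1.
have /sigma_finiteP[G [TG incG finG]] := sigma_finiteT m2.
exists (fun n => F n `*` G n) => [|n].
  apply/esym; rewrite -subTset => -[x y] _.
  have [i _ Fix] : (\bigcup_i F i) x by rewrite -TF.
  have [j _ Gjy] : (\bigcup_i G i) y by rewrite -TG.
  (* The exhausting sequences are increasing, so one index serves both factors. *)
  exists (maxn i j) => //; split.
    by move/subsetPset: (incF _ _ (leq_maxl i j)); apply.
  by move/subsetPset: (incG _ _ (leq_maxr i j)); apply.
have [[mF fF] [mG fG]] := (finF n, finG n); split; first exact: measurableX.
by rewrite product_measure1E // lte_mul_pinfty // ge0_fin_numE.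
Qed.

(** The library provides no sigma-finite measure structure on [m1 \x m2], which
    iterated products require. *)
Definition sf_product d1 d2 (T1 : measurableType d1) (T2 : measurableType d2)
    (m1 : {sigma_finite_measure set T1 -> \bar R})
    (m2 : {sigma_finite_measure set T2 -> \bar R}) :
    {sigma_finite_measure set (T1 * T2)%type -> \bar R} :=
  HB.pack_for {sigma_finite_measure set (T1 * T2)%type -> \bar R} (m1 \x m2)%E
    (Measure_isSigmaFinite.Build _ _ _ (m1 \x m2)%E (sigma_finite_product m1 m2)).

Lemma finite_on_setX d (T : measurableType d)
    (m : {sigma_finite_measure set T -> \bar R}) (B : set T) (I : set R) :
  finite_on m B -> finite_on leb I -> finite_on (sf_product m leb) (B `*` I).
Proof.
move=> [mB fB] [mI fI]; split; first exact: measurableX.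
by rewrite [X in (X < _)%E]product_measure1E // lte_mul_pinfty // ge0_fin_numE.
Qed.

Lemma integral_bounded_on_first d (T : measurableType d)
    (m : {sigma_finite_measure set T -> \bar R}) B I (f : T * R -> R) :
  finite_on m B -> finite_on leb I -> bounded_on (B `*` I) f ->
  (forall y, \int[m]_x (f (x, y))%:E = 0)%E ->
  (\int[sf_product m leb]_z (f z)%:E = 0)%E.
Proof.
move=> fB fI bf f0; apply: integral_prod_first => //.
exact: (bounded_on_integrable (finite_on_setX fB fI) bf).
Qed.

Lemma integral_bounded_on_last d (T : measurableType d)
    (m : {sigma_finite_measure set T -> \bar R}) B I (f : T * R -> R) :
  finite_on m B -> finite_on leb I -> bounded_on (B `*` I) f ->
  (forall x, \int[leb]_y (f (x, y))%:E = 0)%E ->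
  (\int[sf_product m leb]_z (f z)%:E = 0)%E.
Proof.
move=> fB fI bf f0; apply: integral_prod_last => //.
exact: (bounded_on_integrable (finite_on_setX fB fI) bf).
Qed.

Lemma ler_coord_norm n (x : 'rV[R]_n) i : `|x 0 i| <= `|x|.
Proof.
rewrite [leRHS]/Num.Def.normr /= mx_normrE.
exact: (le_bigmax _ (fun j : 'I_1 * 'I_n => `|x j.1 j.2|) (0, i)).
Qed.

Lemma integral_derive1_compact (h : R -> R) (a : R) :
  (forall y, derivable h y 1) -> continuous (derive1 h) ->
  (forall y, a < `|y| -> h y = 0) ->
  (\int[leb]_y ((derive1 h) y)%:E = 0)%E.
Proof.
(* Since a may be negative, b is chosen positive as well as beyond a; h then vanishes at both ends
   of [-b, b]. *)
move=> dh ch h0; pose b : R := `|a| + 1.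
have ab : a < b by rewrite (le_lt_trans (ler_norm a)) // ltrDl.
have b0 : 0 < b by rewrite ltr_wpDl.
have hc : continuous h by move=> y; apply: differentiable_continuous; exact/derivable1_diffP.
have h'0 y : b < `|y| -> (derive1 h) y = 0.
  move=> by_; rewrite derive1E (@near_eq_derive _ _ _ _ (cst 0)) ?derive_cst //.
  near=> z; apply: h0; apply: (lt_trans ab).
  by near: z; apply: (cvgr_gt `|y|) => //; exact: norm_continuous.
transitivity (\int[leb]_(y in `[(- b)%R, b]) ((derive1 h) y)%:E)%E.
  rewrite [RHS]integral_mkcond; apply: eq_integral => y _; rewrite patchE.
  case: ifPn => // /negP; rewrite inE /= in_itv /= -ler_norml => /negP.
  by rewrite -ltNge => /h'0 ->.
transitivity ((h b)%:E - (h (- b))%:E)%E; last first.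
  by rewrite !h0 ?subee // ?normrN gtr0_norm.
apply: continuous_FTC2; last by move=> x _.
- by rewrite gtrN.
- by apply: continuous_subspaceT.
- split; first by move=> x _; exact: dh.
  + exact: cvg_at_right_filter (hc _).
  + exact: cvg_at_left_filter (hc _).
Unshelve. all: by end_near. Qed.

Definition lebesgue7_measure :=
  sf_product (sf_product (sf_product (sf_product (sf_product (sf_product
    leb leb) leb) leb) leb) leb) leb.

Section Coordinates.
Variables (g : 'rV[R]_7 -> R) (a : R).
Hypotheses (dg : forall x, differentiable (g : _ -> R^o) x)
  (cg : forall v, continuous ('D_v (g : _ -> R^o)))
  (g0 : forall x, a < `|x| -> g x = 0).

Lemma integral_derive_line (i : 'I_7) (c : R -> 'rV[R]_7) :
  (forall y, c y = c 0 + y *: delta_mx 0 i) ->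
  (\int[leb]_y ('D_(delta_mx 0 i) (g : _ -> R^o) (c y))%:E = 0)%E.
Proof.
move=> cE; set e : 'rV[R]_7 := delta_mx 0 i.
pose h (y : R) : R := g (c 0 + y *: e).
(* The difference quotients of h and of g along the line are the same function, so derivability and
   the derivative transfer at once. *)
have quot y : (fun t : R => t^-1 *: ((h \o shift y) (t *: (1 : R)) - h y) : R^o) =
    (fun t : R => t^-1 *: (((g : _ -> R^o) \o shift (c y)) (t *: e) - g (c y))).
  apply/funext => t; rewrite /h /= (cE y); congr (_ *: (g _ - _)).
  by rewrite scalerDl /GRing.scale /= mulr1 addrCA.
have hE y : derive1 h y = 'D_e (g : _ -> R^o) (c y).
  by rewrite derive1E /derive quot.
have dh y : derivable h y 1.
  rewrite /derivable quot; exact: (diff_derivable (dg _)).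
transitivity (\int[leb]_y (derive1 h y)%:E)%E.
  by apply: eq_integral => y _; rewrite hE.
have ci : continuous c.
  move=> y; rewrite (_ : c = fun y => c 0 + y *: e); last exact/funext.
  by apply: cvgD; [exact: cvg_cst|exact: scalel_continuous].
(* The i-th coordinate of [c y] is y plus that of [c 0], so |y| > |a| + |c 0| forces |c y| > |a|. *)
apply: (@integral_derive1_compact _ (`|a| + `|c 0|)); first exact: dh.
  rewrite (_ : derive1 h = 'D_e (g : _ -> R^o) \o c); last exact/funext.
  by move=> y; apply: continuous_comp; [exact: ci|exact: cg].
move=> y ay; apply: g0; rewrite (le_lt_trans (ler_norm a)) //.
have h1 : `|c y 0 i| <= `|c y| := ler_coord_norm _ _.
have h2 : `|c 0 0 i| <= `|c 0| := ler_coord_norm _ _.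
have yE : y = c y 0 i - c 0 0 i by rewrite cE !mxE !eqxx mulr1 addrAC subrr add0r.
have := ler_normB (c y 0 i) (c 0 0 i); rewrite -yE -cE => h3.
lra.
Qed.

Let I : set R := `[(- a), a]%classic.
Let box : set (R7 R) := I `*` I `*` I `*` I `*` I `*` I `*` I.

Lemma finite_on_itv : finite_on leb I.
Proof.
split; first exact: measurable_itv.
by rewrite lebesgue_measure_itv; case: ifP => // _; rewrite -EFinB ltry.
Qed.

Lemma finite_on_box : finite_on lebesgue7_measure box.
Proof.
have F1 := finite_on_itv.
by do 6![apply: finite_on_setX => //].
Qed.

(** The norm of a row vector is its largest coordinate in absolute value, so the closed ball of
    radius a is a cube. *)
Lemma notin_box t : ~ box t -> a < `|row7 t|.
Proof.
move=> nbt; rewrite ltNge; apply/negP => ta; apply: nbt.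
have tI i : I (row7 t 0 i).
  by rewrite /I /= in_itv /= -ler_norml (le_trans (ler_coord_norm _ _)).
case: t {ta} tI => [[[[[[x1 x2] x3] x4] x5] x6] x7] tI.
have := tI (@Ordinal 7 0 isT); have := tI (@Ordinal 7 1 isT).
have := tI (@Ordinal 7 2 isT); have := tI (@Ordinal 7 3 isT).
have := tI (@Ordinal 7 4 isT); have := tI (@Ordinal 7 5 isT).
by have := tI (@Ordinal 7 6 isT); rewrite /row7 !mxE /= /box.
Qed.

Lemma derive_out v x : a < `|x| -> 'D_v (g : _ -> R^o) x = 0.
Proof.
move=> ax; rewrite (@near_eq_derive _ _ _ _ (cst 0)) ?derive_cst //.
near=> z; apply: g0.
by near: z; apply: (cvgr_gt `|x|) => //; exact: norm_continuous.
Unshelve. all: by end_near. Qed.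

Lemma bounded_on_derive v :
  bounded_on box (fun t => 'D_v (g : _ -> R^o) (row7 t)).
Proof.
split.
- exact: (measurable_row7_continuous (@cg v)).
- have cB : compact [set x : 'rV[R]_7 | `|x| <= a].
    apply: bounded_closed_compact.
      by exists a; split; [exact: num_real|move=> r ar x /= xa; rewrite (le_trans xa) // ltW].
    apply: (@preimage_closed _ _ (@Num.norm _ 'rV[R]_7) [set r | r <= a]); last exact: closed_le.
    by move=> x _; exact: norm_continuous.
  have /compact_bounded[K [_ KP]] : compact ('D_v (g : _ -> R^o) @` [set x | `|x| <= a]).
    by apply: continuous_compact => //; apply: continuous_subspaceT; exact: cg.
  exists (`|K| + 1) => t; have [ta|ta] := leP `|row7 t| a.
    by apply: KP; [rewrite (le_lt_trans (ler_norm K)) // ltrDl|exists (row7 t)].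
  by rewrite derive_out // normr0 addr_ge0.
- by move=> t /notin_box; exact: derive_out.
Qed.

(** The product is nested to the left: the coordinates after i are fixed from the outside in until
    direction i is the last factor, and then the integral along it vanishes. *)
Lemma integral_derive_row7 (i : 'I_7) :
  (\int[@lebesgue7 R]_t ('D_(delta_mx 0 i) (g : _ -> R^o) (row7 t))%:E = 0)%E.
Proof.
have F1 := finite_on_itv; have F2 := finite_on_setX F1 F1.
have F3 := finite_on_setX F2 F1; have F4 := finite_on_setX F3 F1.
have F5 := finite_on_setX F4 F1; have F6 := finite_on_setX F5 F1.
have b7 := bounded_on_derive (delta_mx 0 i).
have b6 x7 := bounded_on_slice1 x7 b7.
have b5 x6 x7 := bounded_on_slice1 x6 (b6 x7).
have b4 x5 x6 x7 := bounded_on_slice1 x5 (b5 x6 x7).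
have b3 x4 x5 x6 x7 := bounded_on_slice1 x4 (b4 x5 x6 x7).
have b2 x3 x4 x5 x6 x7 := bounded_on_slice1 x3 (b3 x4 x5 x6 x7).
have line (c : R -> R7 R) :
    (forall y, row7 (c y) = row7 (c 0) + y *: delta_mx 0 i) ->
    (\int[leb]_y ('D_(delta_mx 0 i) (g : _ -> R^o) (row7 (c y)))%:E = 0)%E.
  by move=> cE; exact: (integral_derive_line (c := row7 (R:=R) \o c) cE).
Ltac row7_line := by
  move=> ?; apply/rowP => -[[|[|[|[|[|[|[|?]]]]]]] // ?];
  rewrite !mxE /= ?mulr0 ?mulr1 ?addr0 ?add0r.
case: i b7 b6 b5 b4 b3 b2 line => [[|[|[|[|[|[|[|k]]]]]]] i7] b7 b6 b5 b4 b3 b2 line //.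
- apply: (integral_bounded_on_first F6 F1 b7) => x7.
  apply: (integral_bounded_on_first F5 F1 (b6 x7)) => x6.
  apply: (integral_bounded_on_first F4 F1 (b5 x6 x7)) => x5.
  apply: (integral_bounded_on_first F3 F1 (b4 x5 x6 x7)) => x4.
  apply: (integral_bounded_on_first F2 F1 (b3 x4 x5 x6 x7)) => x3.
  apply: (integral_bounded_on_first F1 F1 (b2 x3 x4 x5 x6 x7)) => x2.
  apply: (line (fun y => (y, x2, x3, x4, x5, x6, x7))).
  row7_line.
- apply: (integral_bounded_on_first F6 F1 b7) => x7.
  apply: (integral_bounded_on_first F5 F1 (b6 x7)) => x6.
  apply: (integral_bounded_on_first F4 F1 (b5 x6 x7)) => x5.
  apply: (integral_bounded_on_first F3 F1 (b4 x5 x6 x7)) => x4.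
  apply: (integral_bounded_on_first F2 F1 (b3 x4 x5 x6 x7)) => x3.
  apply: (integral_bounded_on_last F1 F1 (b2 x3 x4 x5 x6 x7)) => x1.
  apply: (line (fun y => (x1, y, x3, x4, x5, x6, x7))).
  row7_line.
- apply: (integral_bounded_on_first F6 F1 b7) => x7.
  apply: (integral_bounded_on_first F5 F1 (b6 x7)) => x6.
  apply: (integral_bounded_on_first F4 F1 (b5 x6 x7)) => x5.
  apply: (integral_bounded_on_first F3 F1 (b4 x5 x6 x7)) => x4.
  apply: (integral_bounded_on_last F2 F1 (b3 x4 x5 x6 x7)) => p.
  case: p => [x1 x2].
  apply: (line (fun y => (x1, x2, y, x4, x5, x6, x7))).
  row7_line.
- apply: (integral_bounded_on_first F6 F1 b7) => x7.
  apply: (integral_bounded_on_first F5 F1 (b6 x7)) => x6.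
  apply: (integral_bounded_on_first F4 F1 (b5 x6 x7)) => x5.
  apply: (integral_bounded_on_last F3 F1 (b4 x5 x6 x7)) => p.
  case: p => [[x1 x2] x3].
  apply: (line (fun y => (x1, x2, x3, y, x5, x6, x7))).
  row7_line.
- apply: (integral_bounded_on_first F6 F1 b7) => x7.
  apply: (integral_bounded_on_first F5 F1 (b6 x7)) => x6.
  apply: (integral_bounded_on_last F4 F1 (b5 x6 x7)) => p.
  case: p => [[[x1 x2] x3] x4].
  apply: (line (fun y => (x1, x2, x3, x4, y, x6, x7))).
  row7_line.
- apply: (integral_bounded_on_first F6 F1 b7) => x7.
  apply: (integral_bounded_on_last F5 F1 (b6 x7)) => p.
  case: p => [[[[x1 x2] x3] x4] x5].
  apply: (line (fun y => (x1, x2, x3, x4, x5, y, x7))).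
  row7_line.
- apply: (integral_bounded_on_last F6 F1 b7) => p.
  case: p => [[[[[x1 x2] x3] x4] x5] x6].
  apply: (line (fun y => (x1, x2, x3, x4, x5, x6, y))).
  row7_line.
Qed.

Lemma integrable_derive_row7 (v : 'rV[R]_7) :
  lebesgue7_measure.-integrable setT
    (fun t => ('D_v (g : _ -> R^o) (row7 t))%:E).
Proof. exact: (bounded_on_integrable finite_on_box (bounded_on_derive v)). Qed.

End Coordinates.
End Stokes.

(** * C^1 functions *)

Section NearEq.
Variables (R : realType) (V W : normedModType R).

(** The difference g - f vanishes near x, so it is differentiable there with zero differential. *)
Lemma near_eq_differentiable (f g : V -> W) (x : V) :
  (\near x, f x = g x) -> differentiable f x -> differentiable g x.
Proof.
move=> fg df; pose h : V -> W := g - f.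
have h0 : \near x, h x = 0.
  by move: fg; apply: filterS => y e; apply/eqP; rewrite subr_eq0 e.
have h_o : h \o shift x = cst (h x) + (\0 : {linear V -> W}) +o_ 0 id.
  apply/eqaddoP => e e0; near=> k.
  rewrite !fctE /= (nbhs_singleton h0) (_ : h (k + x) = 0).
    have -> : `|0 - (0 + 0) : W| = 0 by rewrite addr0 subr0 normr0.
    by rewrite mulr_ge0 // ltW.
  near: k; have := h0; rewrite (near_shift 0 x) /=.
  by apply: filterS => y; rewrite subr0.
have dh : differentiable h x.
  have c0 : continuous (\0 : {linear V -> W}) by move=> y; exact: cvg_cst.
  apply/diff_locallyP; rewrite (diff_unique c0 h_o); split => //.
rewrite (_ : g = f + h); first exact: differentiableD.
by apply/funext => y; rewrite /h !fctE addrC subrK.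
Unshelve. all: by end_near. Qed.

Lemma near_eq_diff (f g : V -> W) (x : V) :
  (\near x, f x = g x) -> differentiable f x -> 'd f x = 'd g x :> (V -> W).
Proof.
move=> fg df; apply/funext => v.
rewrite -!deriveE //; last exact: near_eq_differentiable df.
exact: near_eq_derive.
Qed.

End NearEq.

Section C1.
Variables (R : realType) (V : normedModType R).

Definition C1 (U : set V) (f : V -> R) :=
  (forall x, U x -> differentiable f x) /\
  (forall v x, U x -> {for x, continuous ('D_v f)}).

Lemma smooth_C1 (U : set V) (f : V -> R) : smooth U (f : V -> R^o) -> C1 U f.
Proof. by move=> /(_ 1%N)[df cf]; split => // v x Ux; exact: cf. Qed.

Lemma continuous_near_eq (T S : topologicalType) (f g : T -> S) (x : T) :
  (\near x, f x = g x) -> {for x, continuous f} -> {for x, continuous g}.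
Proof.
move=> fg cf; rewrite /prop_for /continuous_at -(nbhs_singleton fg).
by apply: cvg_trans cf; exact: near_eq_cvg.
Qed.

Lemma C1M (U : set V) f g : open U -> C1 U f -> C1 U g -> C1 U (fun x => f x * g x).
Proof.
move=> oU [df cf] [dg cg]; split=> [x Ux|v x Ux].
  by apply: differentiableM; [exact: df|exact: dg].
apply: (@continuous_near_eq _ _ (fun x => f x * 'D_v g x + g x * 'D_v f x)).
  near=> y; have Uy : U y by near: y; exact: open_nbhs_nbhs.
  by rewrite [RHS]deriveM //; apply: diff_derivable; [exact: df|exact: dg].
apply: cvgD; apply: cvgM.
- by apply: differentiable_continuous; exact: df.
- exact: cg.
- by apply: differentiable_continuous; exact: dg.
- exact: cf.
Unshelve. all: by end_near. Qed.

Lemma C1D (U : set V) f g : open U -> C1 U f -> C1 U g -> C1 U (fun x => f x + g x).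
Proof.
move=> oU [df cf] [dg cg]; split=> [x Ux|v x Ux].
  by apply: differentiableD; [exact: df|exact: dg].
apply: (@continuous_near_eq _ _ (fun x => 'D_v f x + 'D_v g x)).
  near=> y; have Uy : U y by near: y; exact: open_nbhs_nbhs.
  by rewrite [RHS]deriveD //; apply: diff_derivable; [exact: df|exact: dg].
by apply: cvgD; [exact: cf|exact: cg].
Unshelve. all: by end_near. Qed.

Lemma C1_cst (U : set V) (c : R) : C1 U (fun=> c).
Proof.
split=> [x Ux|v x Ux]; first exact: differentiable_cst.
rewrite (_ : 'D_v _ = cst 0); first exact: cst_continuous.
by apply/funext => y; exact: derive_cst.
Qed.

Lemma C1V (U : set V) f : open U -> C1 U f -> (forall x, U x -> f x != 0) ->
  C1 U (fun x => (f x)^-1).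
Proof.
move=> oU [df cf] f0; split=> [x Ux|v x Ux].
  by apply: differentiableV; [exact: df|exact: f0].
apply: (@continuous_near_eq _ _ (fun x => - (f x)^-1 ^+ 2 * 'D_v f x)).
  near=> y; have Uy : U y by near: y; exact: open_nbhs_nbhs.
  rewrite [RHS]deriveV ?exprVn //; first exact: f0.
  by apply: diff_derivable; exact: df.
apply: cvgM; last exact: cf.
apply: cvgN; apply: (@continuous_comp _ _ _ (fun x => (f x)^-1) (fun y => y ^+ 2)).
  apply: cvgV; first exact: f0.
  by apply: differentiable_continuous; exact: df.
exact: exprn_continuous.
Unshelve. all: by end_near. Qed.

Lemma C1_sum (U : set V) (I : Type) (r : seq I) (P : pred I) (F : I -> V -> R) :
  open U -> (forall i, C1 U (F i)) -> C1 U (fun x => \sum_(i <- r | P i) F i x).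
Proof.
move=> oU cF; elim: r => [|i r IH].
  rewrite (_ : (fun x => _) = fun=> 0); first exact: C1_cst.
  by apply/funext => x; rewrite big_nil.
rewrite (_ : (fun x => _) = fun x => (if P i then F i x else 0) +
    \sum_(j <- r | P j) F j x); last first.
  by apply/funext => x; rewrite big_cons; case: ifP => //; rewrite add0r.
apply: C1D; [exact: oU| |exact: IH].
by case: (P i); [exact: cF|exact: C1_cst].
Qed.

Lemma C1_ext (U : set V) f g : open U -> (forall x, U x -> f x = g x) ->
  C1 U f -> C1 U g.
Proof.
move=> oU fg [df cf].
have nfg x : U x -> \near x, f x = g x.
  by move=> Ux; near=> y; apply: fg; near: y; exact: open_nbhs_nbhs.
split=> [x Ux|v x Ux].
  by apply: near_eq_differentiable (df x Ux); exact: nfg.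
apply: continuous_near_eq (cf v x Ux).
near=> y; apply: near_eq_derive; apply: nfg.
by near: y; exact: open_nbhs_nbhs.
Unshelve. all: by end_near. Qed.

Lemma C1_continuous (U : set V) f x : C1 U f -> U x -> {for x, continuous f}.
Proof. by move=> [df _] Ux; apply: differentiable_continuous; exact: df. Qed.

Lemma C1_sub (U U' : set V) f : U `<=` U' -> C1 U' f -> C1 U f.
Proof. by move=> UU' [df cf]; split=> [x /UU'|v x /UU']; [exact: df|exact: cf]. Qed.

End C1.

(** * The chain rule and a C^1 bump function *)

Section C1Comp.
Variables (R : realType).

Lemma C1_comp1 (V : normedModType R) (U : set V) (f : V -> R) (h : R -> R) :
  open U -> C1 U f -> (forall y, derivable h y 1) -> continuous (derive1 h) ->
  C1 U (h \o f).
Proof.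
move=> oU [df cf] dh ch.
have dh' y : differentiable h y by exact/derivable1_diffP.
split=> [x Ux|v x Ux].
  by apply: differentiable_comp; [exact: df|exact: dh'].
apply: (@continuous_near_eq _ _ (fun x => derive1 h (f x) * 'D_v f x)).
  near=> y; have Uy : U y by near: y; exact: open_nbhs_nbhs.
  rewrite [RHS]deriveE; last by apply: differentiable_comp; [exact: df|exact: dh'].
  rewrite diff_comp //; [|exact: df] => /=.
  rewrite (deriv1E (dh _)) /= deriveE; last exact: df.
  by rewrite mulrC.
apply: cvgM; last exact: cf.
apply: (@continuous_comp _ _ _ f (derive1 h)); last exact: ch.
by apply: differentiable_continuous; exact: df.
Unshelve. all: by end_near. Qed.

Lemma diff_row n (f : 'rV[R]_n -> R) (y w : 'rV[R]_n) : differentiable f y ->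
  'd f y w = \sum_i w 0 i * 'D_(delta_mx 0 i) f y.
Proof.
move=> df; rewrite {1}(row_sum_delta w) linear_sum; apply: eq_bigr => i _.
by rewrite linearZ deriveE.
Qed.

Lemma cvg_sumr (T I : Type) (F : set_system T) {FF : Filter F} (r : seq I)
    (P : pred I) (f : I -> T -> R) (l : I -> R) :
  (forall i, P i -> f i x @[x --> F] --> l i) ->
  \sum_(i <- r | P i) f i x @[x --> F] --> \sum_(i <- r | P i) l i.
Proof. by move=> fl; apply: cvg_big => //; exact: add_continuous. Qed.

Lemma cvg_prodr (T I : Type) (F : set_system T) {FF : Filter F} (r : seq I)
    (P : pred I) (f : I -> T -> R) (l : I -> R) :
  (forall i, P i -> f i x @[x --> F] --> l i) ->
  \prod_(i <- r | P i) f i x @[x --> F] --> \prod_(i <- r | P i) l i.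
Proof. by move=> fl; apply: cvg_big => //; exact: mul_continuous. Qed.

(** The chain rule is written with partial derivatives of f, so that continuity can be checked term
    by term. *)
Lemma C1_comp n m (U : set 'rV[R]_n) (W : set 'rV[R]_m)
    (T : 'rV[R]_n -> 'rV[R]_m) (f : 'rV[R]_m -> R) :
  open U -> Ck 1 U T -> (forall x, U x -> W (T x)) -> C1 W f -> C1 U (f \o T).
Proof.
move=> oU [dT cT] UW [df cf]; split=> [x Ux|v x Ux].
  by apply: differentiable_comp; [exact: dT|exact/df/UW].
apply: (@continuous_near_eq _ _
    (fun x => \sum_i ('D_v T x) 0 i * 'D_(delta_mx 0 i) f (T x))).
  near=> y; have Uy : U y by near: y; exact: open_nbhs_nbhs.
  have dTy := dT y Uy; have dfy := df (T y) (UW y Uy).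
  rewrite [RHS]deriveE; last exact: differentiable_comp.
  by rewrite diff_comp //= diff_row // deriveE.
have cTx : {for x, continuous T} by apply: differentiable_continuous; exact: dT.
apply: (cvg_sumr (F := nbhs x)) => i _; apply: cvgM.
  apply: (@continuous_comp _ _ _ ('D_v T) (fun M : 'rV[R]_m => M 0 i)); first exact: cT.
  exact: coord_continuous.
by apply: (@continuous_comp _ _ _ T ('D_(delta_mx 0 i) f)) => //; exact/cf/UW.
Unshelve. all: by end_near. Qed.

(** t |-> max(0, t)^2, which is C^1, as suffices for a partition of unity. *)
Definition sqpos (t : R) : R := Num.max 0 t ^+ 2.

Lemma is_derive_sqpos (t : R) : is_derive t (1 : R) sqpos (2 * Num.max 0 t).
Proof.
have [t0|t0|->] := ltrgtP t 0.
- rewrite mulr0; apply: (near_eq_is_derive (f := cst 0)).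
    near=> s; rewrite /sqpos max_l ?expr0n //; apply: ltW.
    by near: s; exact: lt_nbhsl.
- have dsq : is_derive t (1 : R) (fun s : R => s ^+ 2 : R) (2 * t).
    apply: DeriveDef; first exact: exprn_derivable.
    by rewrite exp_derive expr1 /GRing.scale /= mulr1 mulr_natl.
  apply: near_eq_is_derive dsq; near=> s; rewrite /sqpos max_r //; apply: ltW.
  by near: s; exact: (cvgr_gt t cvg_id).
- rewrite mulr0.
  (* At 0 the difference quotient is at most |h| in absolute value. *)
  have q0 : (h^-1 *: ((sqpos \o shift 0) (h *: (1 : R)) - sqpos 0) : R)
      @[h --> 0^'] --> (0 : R).
    apply/cvgrPdist_le => e e0; near=> h.
    have h0 : h != 0 by near: h; exact: nbhs_dnbhs_neq.
    rewrite /= /GRing.scale /= mulr1 addr0 /sqpos maxxx expr0n subr0 sub0r normrN.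
    have he : `|h| <= e by near: h; exact: dnbhs0_le.
    apply: le_trans he; rewrite normrM normfV ler_pdivrMl ?normr_gt0 //.
    rewrite normrX -expr2; apply: lerXn2r; rewrite ?nnegrE //.
    by have [h_le0|h_gt0] := leP h 0; rewrite ?normr0.
  by apply: DeriveDef; [exact: (cvgP _ q0)|exact: (cvg_lim _ q0)].
Unshelve. all: by end_near. Qed.

Lemma derivable_sqpos (t : R) : derivable sqpos t (1 : R).
Proof. by have [] := is_derive_sqpos t. Qed.

Lemma continuous_derive1_sqpos : continuous (derive1 sqpos).
Proof.
rewrite (_ : derive1 sqpos = fun t => 2 * Num.max 0 t); last first.
  by apply/funext => t; rewrite derive1E; have [] := is_derive_sqpos t.
move=> t; apply: cvgM; first exact: cvg_cst.
by apply: continuous_max; [exact: cst_continuous|exact: cvg_id].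
Qed.

Section Bump.
Variables (n : nat) (a : 'rV[R]_n) (r : R).

(** A sum of squares is used because it is smooth, unlike the maximum norm. The Euclidean ball of
    radius r lies in the norm ball, so the support is still controlled. *)
Definition bump (x : 'rV[R]_n) : R :=
  sqpos (r ^+ 2 - \sum_i (x 0 i - a 0 i) ^+ 2).

Lemma bump_ge0 x : 0 <= bump x.
Proof. by rewrite /bump /sqpos exprn_even_ge0. Qed.

Lemma bump_center : 0 < r -> 0 < bump a.
Proof.
move=> r0; rewrite /bump big1 ?subr0 => [|i _]; last by rewrite subrr expr0n.
by rewrite /sqpos max_r ?exprn_gt0 // ltW // exprn_gt0.
Qed.

Lemma bump_out x : 0 < r -> r <= `|x - a| -> bump x = 0.
Proof.
move=> r0 rx; have [i ri] : exists i, r <= `|x 0 i - a 0 i|.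
  have xa0 : mx_norm (x - a) != 0.
    by rewrite gt_eqF // (lt_le_trans r0).
  have [[j i] xaE] := mx_norm_neq0 xa0; exists i.
  by move: rx; rewrite /Num.Def.normr /= xaE /= (ord1 j) !mxE.
rewrite /bump /sqpos max_l ?expr0n //; rewrite subr_le0 (bigD1 i) //=.
apply: ler_wpDr; first by apply: sumr_ge0 => j _; exact: sqr_ge0.
by rewrite -(real_normK (num_real (x 0 i - a 0 i))) lerXn2r ?nnegrE // ltW.
Qed.

Lemma C1_coord (U : set 'rV[R]_n) i : C1 U (fun x : 'rV[R]_n => x 0 i).
Proof.
have dc (x : 'rV[R]_n) : differentiable (fun x : 'rV[R]_n => x 0 i : R) x.
  exact: differentiable_coord.
split=> [x _|v x _]; first exact: dc.
rewrite (_ : 'D_v _ = cst (v 0 i)); first exact: cst_continuous.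
apply/funext => y.
have := derive_mx (@derivable_id _ _ y v); rewrite derive_id => /matrixP /(_ 0 i).
by rewrite mxE.
Qed.

Lemma C1_bump (U : set 'rV[R]_n) : C1 U bump.
Proof.
apply: (@C1_sub _ _ _ setT) => //.
apply: C1_comp1; [exact: openT| |exact: derivable_sqpos|exact: continuous_derive1_sqpos].
have C1B c (f : 'rV[R]_n -> R) : C1 setT f -> C1 setT (fun x => c - f x).
  move=> cf; apply: C1D; [exact: openT|exact: C1_cst|].
  apply: (@C1_ext _ _ _ (fun x => -1 * f x)); [exact: openT| |].
    by move=> x _; rewrite mulN1r.
  by apply: C1M; [exact: openT|exact: C1_cst|].
apply: C1B; apply: C1_sum => [|i]; first exact: openT.
have C1i : C1 setT (fun x : 'rV[R]_n => x 0 i - a 0 i).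
  by apply: C1D; [exact: openT|exact: C1_coord|exact: C1_cst].
apply: (@C1_ext _ _ _ (fun x : 'rV[R]_n => (x 0 i - a 0 i) * (x 0 i - a 0 i))).
- exact: openT.
- by move=> x _; rewrite expr2.
- by apply: C1M; [exact: openT| |].
Qed.

End Bump.

End C1Comp.

(** * Charts and the volume form *)

Section Charts.
Variables (R : realType) (n : nat) (M : topologicalType) (X : manifold R n M).
Implicit Types (c : chart R n M) (x : 'rV[R]_n) (p : M).

Lemma mul_jacobian (f : 'rV[R]_n -> 'rV[R]_n) x v : v *m 'J f x = 'd f x v.
Proof. by rewrite /jacobian mul_rV_lin1. Qed.

Lemma crd_inv_rng c x : atlas X c -> chart_rng c x ->
  chart_dom c (crd_inv c x) /\ crd c (crd_inv c x) = x.
Proof. by move=> ac [p dp <-]; rewrite (crdK ac dp). Qed.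

Lemma chart_rng_crd c p : chart_dom c p -> chart_rng c (crd c p).
Proof. by move=> dp; exists p. Qed.

Definition overlap c c' := crd c @` (chart_dom c `&` chart_dom c').

Lemma overlapP c c' x : atlas X c ->
  overlap c c' x <-> chart_rng c x /\ chart_dom c' (crd_inv c x).
Proof.
move=> ac; split=> [[p [dp dp'] <-]|[/(crd_inv_rng ac)[dx xE] dx']].
  by rewrite (crdK ac dp); split => //; exists p.
by exists (crd_inv c x).
Qed.

Lemma open_overlap c c' : atlas X c -> atlas X c' -> open (overlap c c').
Proof.
move=> ac ac'; rewrite openE => x /(overlapP _ _ ac)[rx dx].
have nd : nbhs (crd_inv c x) (chart_dom c').
  by apply: open_nbhs_nbhs; split => //; exact: open_dom ac'.
have nr : nbhs x (chart_rng c) by apply: open_nbhs_nbhs; split => //; exact: open_rng ac.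
have := crd_inv_continuous ac rx nd; rewrite /interior nbhs_simpl /=.
by move: nr; apply: filterS2 => y ry dy; apply/overlapP.
Qed.

Definition transition c c' := crd c' \o crd_inv c.

Lemma transition_Ck1 c c' : atlas X c -> atlas X c' ->
  Ck 1 (overlap c c') (transition c c').
Proof. by move=> ac ac'; exact: (transition_smooth ac ac' 1%N). Qed.

Lemma differentiable_transition c c' x : atlas X c -> atlas X c' ->
  overlap c c' x -> differentiable (transition c c') x.
Proof. by move=> ac ac' ox; have [d _] := transition_Ck1 ac ac'; exact: d. Qed.

Lemma transition_near (T : Type) (f : M -> T) c c' x : atlas X c -> atlas X c' ->
  overlap c c' x ->
  \near x, (f \o crd_inv c') (transition c c' x) = (f \o crd_inv c) x.
Proof.
move=> ac ac' ox; near=> y.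
have /(overlapP _ _ ac)[ry dy] : overlap c c' y.
  by near: y; apply: open_nbhs_nbhs; split => //; exact: open_overlap.
by rewrite /transition /= (crdK ac' dy).
Unshelve. all: by end_near. Qed.

Lemma overlap_transition c c' c'' x : atlas X c -> atlas X c' -> atlas X c'' ->
  overlap c c' x -> chart_dom c'' (crd_inv c x) ->
  overlap c' c'' (transition c c' x).
Proof.
move=> ac ac' ac'' /(overlapP _ _ ac)[rx dx] dx''; apply/(overlapP _ _ ac').
by rewrite /transition /= (crdK ac' dx); split => //; exists (crd_inv c x).
Qed.

(** This is the chain rule; the factorisation through c' holds only near x, which is enough for
    differentials. *)
Lemma diff_transition (W : normedModType R) (f : M -> W) c c' x v :
  atlas X c -> atlas X c' -> overlap c c' x ->
  differentiable (f \o crd_inv c') (transition c c' x) ->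
  'd (f \o crd_inv c) x v =
  'd (f \o crd_inv c') (transition c c' x) ('d (transition c c') x v).
Proof.
move=> ac ac' ox df; have dt := differentiable_transition ac ac' ox.
have dft : differentiable ((f \o crd_inv c') \o transition c c') x.
  exact: differentiable_comp.
have e : 'd ((f \o crd_inv c') \o transition c c') x = 'd (f \o crd_inv c) x
    :> ('rV[R]_n -> W).
  by apply: near_eq_diff dft; exact: transition_near.
have ev := congr1 (fun h : 'rV[R]_n -> W => h v) e.
apply: etrans (esym ev) _.
exact: (congr1 (fun h : 'rV[R]_n -> W => h v) (diff_comp dt df)).
Qed.

Lemma mul_chart_jac c x v :
  v *m chart_jac X c x = 'd (transition c (chart_at X (crd_inv c x))) x v.
Proof. exact: mul_jacobian. Qed.

(** Both Jacobians end in the preferred chart of the same point, so this is again the chain rule, in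
    row-vector order. *)
Lemma chart_jac_transition c c' x : atlas X c -> atlas X c' -> overlap c c' x ->
  chart_jac X c x =
  'J (transition c c') x *m chart_jac X c' (transition c c' x).
Proof.
move=> ac ac' ox; have /(overlapP _ _ ac)[rx dx] := ox.
have ae := atlas_chart_at X (crd_inv c x).
have pE : crd_inv c' (transition c c' x) = crd_inv c x.
  by rewrite /transition /= (crdK ac' dx).
apply/eqP/mulmxP => v; apply: etrans (mul_chart_jac _ _ _) _.
rewrite mulmxA; apply/esym; apply: etrans (mul_chart_jac _ _ _) _.
rewrite pE; apply: etrans (congr1 _ (mul_jacobian _ _ _)) _.
apply/esym; apply: diff_transition => //.
apply: (differentiable_transition ac' ae); apply: (overlap_transition ac ac' ae ox).
exact: dom_chart_at.
Qed.

Lemma chart_jac_chart_at p : chart_jac X (chart_at X p) (crd (chart_at X p) p) = 1%:M.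
Proof.
set c := chart_at X p; have ac : atlas X c := atlas_chart_at X p.
have dp : chart_dom c p := dom_chart_at X p.
apply/eqP/mulmxP => v; rewrite mul_chart_jac mulmx1 (crdK ac dp) -/c.
have idn : \forall y \near crd c p, id y = transition c c y.
  near=> y; have ry : chart_rng c y.
    near: y; apply: open_nbhs_nbhs; split; first exact: open_rng ac.
    exact: chart_rng_crd.
  by rewrite /transition /= (crd_inv_rng ac ry).2.
have did : differentiable (@id 'rV[R]_n) (crd c p) by [].
have e : 'd (@id 'rV[R]_n) (crd c p) = 'd (transition c c) (crd c p)
    :> ('rV[R]_n -> 'rV[R]_n) by exact: near_eq_diff.
apply: etrans (esym (congr1 (fun h : 'rV[R]_n -> 'rV[R]_n => h v) e)) _.
by rewrite diff_val.
Unshelve. all: by end_near. Qed.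

(** Passing from the preferred chart to c and on to the tangent space gives the identity, of which
    [chart_jac X c x] is thus a right factor. *)
Lemma chart_jac_unit c x : atlas X c -> chart_rng c x -> chart_jac X c x \in unitmx.
Proof.
move=> ac rx; have [dx xE] := crd_inv_rng ac rx; set p := crd_inv c x.
have ae := atlas_chart_at X p; have dp := dom_chart_at X p.
have := chart_jac_chart_at p.
rewrite (chart_jac_transition ae ac); last by exists p.
rewrite {2}/transition /= (crdK ae dp) xE => /mulmx1_unit[] //.
Qed.

Definition C1_fun (f : M -> R) :=
  forall c, atlas X c -> C1 (chart_rng c) (f \o crd_inv c).

Definition dfun (f : M -> R) (p : M) : kform R n 1 := fun V =>
  'd (f \o crd_inv (chart_at X p)) (crd (chart_at X p) p) (row 0 V).

(** Although [dfun] uses a different chart at each point, in every chart it is the usual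
    differential. *)
Lemma local_dfun f c x : C1_fun f -> atlas X c -> chart_rng c x ->
  forall V, local_form X (dfun f) c x V = 'd (f \o crd_inv c) x (row 0 V).
Proof.
move=> Cf ac rx V; have [dx xE] := crd_inv_rng ac rx; set p := crd_inv c x.
have ae := atlas_chart_at X p; have dp := dom_chart_at X p.
have ox : overlap c (chart_at X p) x by apply/overlapP.
rewrite (@diff_transition _ f c (chart_at X p)) //; last first.
  by have [d _] := Cf _ ae; apply: d; exists p.
by rewrite /local_form /pullback /dfun row_mul mul_chart_jac.
Qed.

Lemma continuous_chart (S : topologicalType) (f : M -> S) :
  (forall p, {for crd (chart_at X p) p, continuous (f \o crd_inv (chart_at X p))}) ->
  continuous f.
Proof.
move=> cf p; set c := chart_at X p; have ac : atlas X c := atlas_chart_at X p.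
have dp : chart_dom c p := dom_chart_at X p.
apply: (@continuous_near_eq _ _ ((f \o crd_inv c) \o crd c)).
  near=> q; have dq : chart_dom c q.
    by near: q; apply: open_nbhs_nbhs; split => //; exact: open_dom ac.
  by rewrite /= (crdK ac dq).
by apply: continuous_comp; [exact: crd_continuous ac _ dp|exact: cf].
Unshelve. all: by end_near. Qed.

End Charts.

(** * Integration against the image of a measure with density *)

Section WeightedImage.
Local Open Scope ereal_scope.
Context d1 d2 (T1 : measurableType d1) (T2 : measurableType d2) (R : realType).
Variables (m1 : {measure set T1 -> \bar R}) (m2 : {measure set T2 -> \bar R}).
Variables (D1 : set T1) (D2 : set T2) (h : T1 -> T2) (w : T1 -> R).
Hypotheses (mD1 : measurable D1) (mD2 : measurable D2).
Hypotheses (mh : measurable_fun D1 h) (hD : forall t, D1 t -> D2 (h t)).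
Hypotheses (mw : measurable_fun D1 w) (w0 : forall t, D1 t -> (0 <= w t)%R).
Hypothesis m2E : forall A, measurable A -> A `<=` D2 ->
  m2 A = \int[m1]_(t in D1 `&` h @^-1` A) (w t)%:E.

Let mcomp (f : T2 -> \bar R) : measurable_fun D2 f -> measurable_fun D1 (f \o h).
Proof.
by move=> mf; apply: (measurable_comp mD2) => // _ [t Dt <-]; exact: hD.
Qed.

Let weighted_indic (E : set T2) : measurable E ->
  \int[m2]_(p in D2) (\1_E p)%:E = \int[m1]_(t in D1) ((\1_E (h t))%:E * (w t)%:E).
Proof.
move=> mE; rewrite integral_indic // m2E; [|exact: measurableI|by move=> p []].
rewrite integral_mkcondr; apply: eq_integral => t; rewrite inE => Dt.
rewrite patchE indicE; case: ifPn => [|/negP].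
  by rewrite inE => -[Et _]; rewrite mem_set // mul1e.
rewrite inE => nE; rewrite memNset ?mul0e // => Et; apply: nE; split => //.
exact: hD.
Qed.

Import HBNNSimple.

Let weighted_nnsfun (f : {nnsfun T2 >-> R}) :
  \int[m2]_(p in D2) (f p)%:E = \int[m1]_(t in D1) ((f (h t))%:E * (w t)%:E).
Proof.
under [LHS]eq_integral do rewrite fimfunE -fsumEFin//.
rewrite [LHS]ge0_integral_fsum//; last 2 first.
  - by move=> r; exact/measurable_EFinP/measurableT_comp.
  - by move=> n x _; rewrite EFinM nnfun_muleindic_ge0.
under [RHS]eq_integral.
  move=> x; rewrite inE => xD; rewrite fimfunE -fsumEFin// muleC ge0_mule_fsumr; last first.
    by move=> r; rewrite EFinM nnfun_muleindic_ge0.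
  over.
have mindic r : measurable_fun D1 (fun t => (\1_(f @^-1` [set r]) (h t))%:E : \bar R).
  apply: (mcomp (f := fun p => (\1_(f @^-1` [set r]) p)%:E)).
  exact/measurable_EFinP.
rewrite [RHS]ge0_integral_fsum//; last 2 first.
  - move=> r; apply: emeasurable_funM; first exact/measurable_EFinP.
    under eq_fun do rewrite EFinM.
    by apply: emeasurable_funM; [exact: measurable_cst|exact: mindic].
  - by move=> n x Dx; rewrite mule_ge0 ?lee_fin ?w0 // -lee_fin EFinM nnfun_muleindic_ge0.
apply: eq_fsbigr => r _; rewrite integralZl_indic_nnsfun // weighted_indic //.
(* The sum over values ranges over all reals; a negative r has empty preimage and contributes 0 to
   both sides. *)
have [r0|r0] := leP 0%R r; last first.
  by rewrite preimage_nnfun0 // indic0 !integral0_eq ?mule0 // => t _;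
    rewrite ?mul0e ?mulr0 ?mule0.
rewrite -ge0_integralZl //; last 2 first.
- by apply: emeasurable_funM; [exact: mindic|exact/measurable_EFinP].
- by move=> t Dt; rewrite mule_ge0 // lee_fin ?w0.
by apply: eq_integral => t _; rewrite [RHS]muleC EFinM muleA.
Qed.

(** Simple functions follow from indicators by linearity, and the general case by monotone
    convergence on both sides. *)
Lemma ge0_integral_weighted (f : T2 -> \bar R) : measurable_fun D2 f ->
  (forall p, D2 p -> 0 <= f p) ->
  \int[m2]_(p in D2) f p = \int[m1]_(t in D1) (f (h t) * (w t)%:E).
Proof.
move=> mf f0; pose f_ := nnsfun_approx mD2 mf.
transitivity (limn (fun n => \int[m2]_(p in D2) (f_ n p)%:E)).
  rewrite -monotone_convergence //=.
  - apply: eq_integral => p /[!inE] Dp; apply/esym/cvg_lim => //=.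
    exact: cvg_nnsfun_approx.
  - by move=> n; exact/measurable_EFinP/measurable_funTS.
  - by move=> n p _; rewrite lee_fin.
  - by move=> p _ a b ab; rewrite lee_fin; exact/lefP/nd_nnsfun_approx.
under eq_fun do rewrite weighted_nnsfun.
rewrite -monotone_convergence //=.
- apply: eq_integral => t /[!inE] Dt; apply/cvg_lim => //=.
  by apply: cvgeZr => //; apply: cvg_nnsfun_approx => //; exact: hD.
- move=> n; apply: emeasurable_funM; last exact/measurable_EFinP.
  apply: (mcomp (f := fun p => (f_ n p)%:E)).
  exact/measurable_EFinP/measurable_funTS.
- by move=> n t Dt; rewrite mule_ge0 // lee_fin ?w0.
- move=> t Dt a b ab; rewrite lee_wpmul2r // ?lee_fin ?w0 //.
  exact/lefP/nd_nnsfun_approx.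
Qed.

(** Multiplication by the nonnegative w commutes with taking positive and negative parts. *)
Lemma integral_weighted (f : T2 -> \bar R) : measurable_fun D2 f ->
  \int[m2]_(p in D2) f p = \int[m1]_(t in D1) (f (h t) * (w t)%:E).
Proof.
move=> mf; rewrite [LHS]integralE [RHS]integralE.
rewrite !ge0_integral_weighted //; last 2 first.
- exact: measurable_funeneg.
- exact: measurable_funepos.
congr (_ - _); apply: eq_integral => t /[!inE] Dt.
  by rewrite !funeposE maxe_pMl ?lee_fin ?w0 // mul0e.
by rewrite !funenegE maxe_pMl ?lee_fin ?w0 // mul0e mulNe.
Qed.

End WeightedImage.

Lemma continuous_root9 (R : realType) (T : topologicalType) (f : T -> R) (x : T) :
  f x != 0 -> {for x, continuous (fun y => f y ^+ 9)} -> (\near x, f x != 0) ->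
  {for x, continuous f}.
Proof.
move=> fx0 cf nf0.
apply: (@continuous_near_eq _ _
  (* f = f^9 / |f|^8, and |f| is a continuous function of f^9. *)
  (fun y => f y ^+ 9 / expR (ln `|f y ^+ 9| / 9%:R) ^+ 8)).
  near=> y; have fy0 : f y != 0 by near: y.
  have e : expR (ln `|f y ^+ 9| / 9%:R) = `|f y|.
    rewrite normrX lnXn ?normr_gt0 // -[ln _ *+ 9]mulr_natr mulfK ?pnatr_eq0 //.
    by rewrite lnK // posrE normr_gt0.
  rewrite e; have -> : `|f y| ^+ 8 = f y ^+ 8.
    by rewrite (exprM _ 2 4) real_normK ?num_real // -exprM.
  by rewrite exprS mulfK // expf_neq0.
apply: cvgM; first exact: cf.
have e0 : expR (ln `|f x ^+ 9| / 9%:R) ^+ 8 != 0 by rewrite expf_neq0 // gt_eqF ?expR_gt0.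
apply: cvgV => //.
apply: (@continuous_comp _ _ _ (fun y => expR (ln `|f y ^+ 9| / 9%:R)) (fun z => z ^+ 8)).
  apply: (@continuous_comp _ _ _ (fun y => ln `|f y ^+ 9| / 9%:R) (@expR R)).
    apply: cvgM; last exact: cvg_cst.
    apply: (@continuous_comp _ _ _ (fun y => `|f y ^+ 9|) (@ln R)).
      apply: (@continuous_comp _ _ _ (fun y => f y ^+ 9) (@Num.norm R R)) => //.
      exact: norm_continuous.
    by apply: continuous_ln; rewrite normr_gt0 expf_neq0.
  exact: continuous_expR.
exact: exprn_continuous.
Unshelve. all: by end_near. Qed.

Section ContinuousAt.
Variables (R : realType) (T : topologicalType) (x : T).
Implicit Types f g : T -> R.

Lemma continuous_at_cst (c : R) : {for x, continuous (fun _ : T => c)}.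
Proof. exact: cvg_cst. Qed.

Lemma continuous_atM f g : {for x, continuous f} -> {for x, continuous g} ->
  {for x, continuous (fun y => f y * g y)}.
Proof. exact: cvgM. Qed.

Lemma continuous_atV f : f x != 0 -> {for x, continuous f} ->
  {for x, continuous (fun y => (f y)^-1)}.
Proof. exact: cvgV. Qed.

Lemma continuous_at_sum (I : Type) (r : seq I) (P : pred I) (F : I -> T -> R) :
  (forall i, {for x, continuous (F i)}) ->
  {for x, continuous (fun y => \sum_(i <- r | P i) F i y)}.
Proof. by move=> cF; apply: cvg_sumr => i _; exact: cF. Qed.

Lemma continuous_at_prod (I : Type) (r : seq I) (P : pred I) (F : I -> T -> R) :
  (forall i, {for x, continuous (F i)}) ->
  {for x, continuous (fun y => \prod_(i <- r | P i) F i y)}.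
Proof. by move=> cF; apply: cvg_prodr => i _; exact: cF. Qed.

Lemma continuous_at_asum (P : ('I_7 -> 'I_7) -> T -> R) :
  (forall s : 'S_7, {for x, continuous (P s)}) ->
  {for x, continuous (fun y => asum (P ^~ y))}.
Proof.
move=> cP; apply: continuous_at_sum => s.
by apply: continuous_atM; [exact: continuous_at_cst|exact: cP].
Qed.

End ContinuousAt.

(** * Metric, volume form and their continuity in charts *)

Section G2Manifold.
Variables (R : realType) (M : topologicalType) (X : manifold R 7 M).
Variables (phi : M -> kform R 7 3) (phi_G2 : G2_structure X phi).
Variables (g : M -> 'M[R]_7) (vol : M -> kform R 7 7).
Hypothesis g_vol : forall p, G2_metric_vol (phi p) (g p) (vol p).

Definition local_vol (c : chart R 7 M) (x : 'rV[R]_7) : R := local_form X vol c x 1%:M.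

Lemma local_G2 c x : atlas X c -> chart_rng c x ->
  exists A : 'M[R]_7, [/\ A \in unitmx, local_form X phi c x =1 pullback A (@phi0 R),
    local_vol c x = \det A & local_metric X g c x = A *m A^T].
Proof.
move=> ac rx; have [A uA [phiE gE volE]] := g_vol (crd_inv c x).
exists (chart_jac X c x *m A); split.
- by rewrite unitmx_mul uA (chart_jac_unit ac rx).
- by move=> V; rewrite /local_form /pullback phiE /pullback mulmxA.
- by rewrite /local_vol /local_form /pullback volE /pullback mul1mx.
- by rewrite /local_metric gE trmx_mul !mulmxA.
Qed.

Lemma local_volE c x : atlas X c -> chart_rng c x ->
  local_vol c x = \det (chart_jac X c x) * vol (crd_inv c x) 1%:M.
Proof.
move=> ac rx; have [A uA [_ _ volE]] := g_vol (crd_inv c x).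
by rewrite /local_vol /local_form /pullback !volE /pullback mul1mx mul1mx det_mulmx.
Qed.

Lemma local_vol_neq0 c x : atlas X c -> chart_rng c x -> local_vol c x != 0.
Proof.
by move=> ac rx; have [A [uA _ -> _]] := local_G2 ac rx; rewrite -unitfE -unitmxE.
Qed.

(** The metric A A^T forgets the sign of det A; this is the absolute value that appears in all
    integrals below. *)
Lemma sqrt_det_local_metric c x : atlas X c -> chart_rng c x ->
  Num.sqrt (\det (local_metric X g c x)) = `|local_vol c x|.
Proof.
move=> ac rx; have [A [uA _ -> ->]] := local_G2 ac rx.
by rewrite det_mulmx det_tr -expr2 sqrtr_sqr.
Qed.

Lemma continuous_local_comp k (w : M -> kform R 7 k) c V x : smooth_form X w ->
  atlas X c -> chart_rng c x -> {for x, continuous (fun x => local_form X w c x V)}.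
Proof. by move=> [_ sw] ac rx; exact: (sw c ac V 0%N x rx). Qed.

Lemma continuous_bryant_mx c x i j : atlas X c -> chart_rng c x ->
  {for x, continuous (fun y => bryant_mx (local_form X phi c y) i j)}.
Proof.
move=> ac rx; have [sphi _] := phi_G2.
rewrite (_ : (fun y => _) = fun y => asum (fun f =>
    comp3 (local_form X phi c y) i (f #0) (f #1) *
    comp3 (local_form X phi c y) j (f #2) (f #3) *
    comp3 (local_form X phi c y) (f #4) (f #5) (f #6))); last first.
  apply/funext => y; rewrite mxE /bryant alt223E; apply: eq_asum => s.
  by rewrite !comp2_contract2.
apply: continuous_at_asum => s /=.
by apply: continuous_atM; first apply: continuous_atM;
  exact: (continuous_local_comp sphi ac rx).
Qed.

Lemma continuous_local_vol c x : atlas X c -> chart_rng c x ->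
  {for x, continuous (local_vol c)}.
Proof.
move=> ac rx; have [sphi _] := phi_G2; apply: continuous_root9.
- exact: local_vol_neq0.
- have c7 : 144 ^+ 7 != 0 :> R by rewrite expf_neq0 // pnatr_eq0.
  apply: (@continuous_near_eq _ _ (fun y =>
    \det (bryant_mx (local_form X phi c y)) / 144 ^+ 7)).
    near=> y; have ry : chart_rng c y.
      near: y; apply: open_nbhs_nbhs; split => //; exact: open_rng ac.
    have [A [uA phiE -> _]] := local_G2 ac ry.
    by rewrite (det_bryant_mx phiE) mulrC (mulKf c7).
  apply: continuous_atM; last exact: continuous_at_cst.
  apply: continuous_at_sum => s; apply: continuous_atM; first exact: continuous_at_cst.
  by apply: continuous_at_prod => i; exact: continuous_bryant_mx.
- near=> y; apply: local_vol_neq0 => //.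
  by near: y; apply: open_nbhs_nbhs; split => //; exact: open_rng ac.
Unshelve. all: by end_near. Qed.

(** Numerator and denominator both pick up the determinant of [chart_jac]. *)
Lemma top322_ratio (b b' : M -> kform R 7 2) c x :
  (forall p, alternating_form (b p)) -> (forall p, alternating_form (b' p)) ->
  atlas X c -> chart_rng c x ->
  top322 (phi (crd_inv c x)) (b (crd_inv c x)) (b' (crd_inv c x)) / vol (crd_inv c x) 1%:M =
  top322 (local_form X phi c x) (local_form X b c x) (local_form X b' c x) / local_vol c x.
Proof.
move=> ab ab' ac rx; rewrite local_volE //.
have [sphi _] := phi_G2; have [mphi _] := sphi.1 (crd_inv c x).
have [mb _] := ab (crd_inv c x); have [mb' _] := ab' (crd_inv c x).
rewrite /local_form top322_pullback // -mulf_div divff ?mul1r //.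
by have := chart_jac_unit ac rx; rewrite unitmxE unitfE.
Qed.

Lemma continuous_top322 (b : M -> kform R 7 2) : smooth_form X b ->
  continuous (fun p => top322 (phi p) (b p) (b p) / vol p 1%:M).
Proof.
move=> sb; apply: (@continuous_chart _ _ _ X) => p; set c := chart_at X p.
have ac : atlas X c := atlas_chart_at X p.
have rp : chart_rng c (crd c p) by exists p => //; exact: dom_chart_at.
apply: (@continuous_near_eq _ _ (fun x => top322 (local_form X phi c x)
    (local_form X b c x) (local_form X b c x) / local_vol c x)).
  near=> x; rewrite /= top322_ratio //; [exact: sb.1|exact: sb.1|].
  by near: x; apply: open_nbhs_nbhs; split => //; exact: open_rng ac.
apply: continuous_atM; last first.
  by apply: continuous_atV; [exact: local_vol_neq0|exact: continuous_local_vol].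
rewrite (_ : (fun x => _) = fun x => asum (fun f =>
    comp3 (local_form X phi c x) (f #0) (f #1) (f #2) *
    comp2 (local_form X b c x) (f #3) (f #4) *
    comp2 (local_form X b c x) (f #5) (f #6))); last first.
  by apply/funext => x; rewrite /top322 alt322E.
apply: continuous_at_asum => s /=; have [sphi _] := phi_G2.
apply: continuous_atM; first apply: continuous_atM.
- exact: (continuous_local_comp sphi ac rp).
- exact: (continuous_local_comp sb ac rp).
- exact: (continuous_local_comp sb ac rp).
Unshelve. all: by end_near. Qed.

End G2Manifold.

Section DeriveSums.
Variables (R : realType) (V : normedModType R).

Lemma is_derive_bigsum (I : Type) (r : seq I) (P : pred I) (F : I -> V -> R)
    (dF : I -> R) (x v : V) :
  (forall i, is_derive x v (F i) (dF i)) ->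
  is_derive x v (fun y => \sum_(i <- r | P i) F i y) (\sum_(i <- r | P i) dF i).
Proof.
move=> dFi; elim: r => [|i r IH].
  rewrite big_nil (_ : (fun y => _) = cst 0); first exact: is_derive_cst.
  by apply/funext => y; rewrite big_nil.
rewrite big_cons; case: ifP => Pi; last first.
  rewrite (_ : (fun y => _) = fun y => \sum_(j <- r | P j) F j y) //.
  by apply/funext => y; rewrite big_cons Pi.
rewrite (_ : (fun y => _) = F i + fun y => \sum_(j <- r | P j) F j y).
  exact: is_deriveD.
by apply/funext => y; rewrite big_cons Pi.
Qed.

Lemma is_derive_mul (f h : V -> R) (df dh : R) (x v : V) :
  is_derive x v f df -> is_derive x v h dh ->
  is_derive x v (fun y => f y * h y) (df * h x + f x * dh).
Proof.
move=> fD hD; apply: (@is_derive_eq _ _ _ (f * h)).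
by rewrite addrC [df * _]mulrC.
Qed.

Lemma is_derive_scale (c : R) (f : V -> R) (df : R) (x v : V) :
  is_derive x v f df -> is_derive x v (fun y => c * f y) (c * df).
Proof.
move=> fD; have := is_derive_mul (is_derive_cst c x v) fD.
by rewrite mul0r add0r.
Qed.

End DeriveSums.

(** * Stokes' theorem *)

Section Divergence.
Variables (R : realType) (M : topologicalType) (X : manifold R 7 M).
Variables (phi : M -> kform R 7 3) (phi_G2 : G2_structure X phi).
Variables (g : M -> 'M[R]_7) (vol : M -> kform R 7 7).
Hypothesis g_vol : forall p, G2_metric_vol (phi p) (g p) (vol p).
Variables (beta : M -> kform R 7 2) (beta_smooth : smooth_form X beta).
Hypothesis phi_exact : is_exterior_derivative X beta phi.

Let bc c x := comp2 (local_form X beta c x).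

Lemma C1_bc c j k : atlas X c -> C1 (chart_rng c) (fun x => bc c x j k).
Proof. by move=> ac; apply: smooth_C1; exact: beta_smooth.2. Qed.

Lemma comp3_exact c x i j k : atlas X c -> chart_rng c x ->
  comp3 (local_form X phi c x) i j k =
  'D_(delta_mx 0 i) (fun y => bc c y j k) x - 'D_(delta_mx 0 j) (fun y => bc c y i k) x +
  'D_(delta_mx 0 k) (fun y => bc c y i j) x.
Proof.
move=> ac rx; rewrite /comp3 (phi_exact ac rx) /dform.
set F := frame R _; pose L y := local_form X beta c y.
have DE (r : 'I_3) (i' j' k' : 'I_7) :
    (forall s, F r s = (i' == s)%:R) ->
    (forall (t : 'I_2) s, F (lift r t) s = (nth j' [:: j'; k'] t == s)%:R) ->
    'D_(row r F) (fun y => L y (row' r F)) x = 'D_(delta_mx 0 i') (fun y => bc c y j' k') x.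
  move=> e1 e2; have -> : row r F = delta_mx 0 i'.
    by apply/rowP => s; rewrite [LHS]mxE e1 mxE eqxx eq_sym.
  have -> // : row' r F = frame R [ffun t : 'I_2 => nth j' [:: j'; k'] t].
  by apply/matrixP => t s; rewrite [LHS]mxE e2 !mxE ffunE.
rewrite !big_ord_recr /= big_ord0 add0r -/F.
rewrite -![local_form X beta c]/L.
rewrite (DE _ i j k); [|by move=> s; rewrite !mxE ffunE|
  by move=> [[|[|?]] // ?] s; rewrite !mxE ffunE].
rewrite (DE _ j i k); [|by move=> s; rewrite !mxE ffunE|
  by move=> [[|[|?]] // ?] s; rewrite !mxE ffunE].
rewrite (DE _ k i j); [|by move=> s; rewrite !mxE ffunE|
  by move=> [[|[|?]] // ?] s; rewrite !mxE ffunE].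
by rewrite /= expr0 mul1r expr1 mulN1r sqrrN expr1n mul1r.
Qed.

Lemma is_derive_vec c x v i : atlas X c -> chart_rng c x ->
  is_derive x v (fun y => vec (bc c y) i)
    (\sum_(s : 'S_7 | s #0 == i) (-1) ^+ s *
      (('D_v (fun y => bc c y (s #1) (s #2)) x *
          bc c x (s #3) (s #4) +
        bc c x (s #1) (s #2) *
          'D_v (fun y => bc c y (s #3) (s #4)) x) *
        bc c x (s #5) (s #6) +
       bc c x (s #1) (s #2) * bc c x (s #3) (s #4) *
        'D_v (fun y => bc c y (s #5) (s #6)) x)).
Proof.
move=> ac rx; apply: is_derive_bigsum => s; apply: is_derive_scale.
have db j k : is_derive x v (fun y => bc c y j k) ('D_v (fun y => bc c y j k) x).
  apply: DeriveDef => //; apply: diff_derivable.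
  by have [d _] := C1_bc j k ac; exact: d.
by apply: is_derive_mul => //; apply: is_derive_mul.
Qed.

Lemma divergence c x : atlas X c -> chart_rng c x ->
  \sum_i 'D_(delta_mx 0 i) (fun y => vec (bc c y) i) x =
  top322 (local_form X phi c x) (local_form X beta c x) (local_form X beta c x).
Proof.
move=> ac rx; rewrite /top322.
rewrite -(@sum_dvec _ _ _ (fun i j k => 'D_(delta_mx 0 i) (fun y => bc c y j k) x)); last first.
  by move=> i j k; exact: comp3_exact.
apply: eq_bigr => i _; have [_ ->] := is_derive_vec (delta_mx 0 i) i ac rx.
apply: eq_bigr => s _; congr (_ * _); rewrite /bc; ring.
Qed.

(** By the normalisation of [alt], this is 24 times the coefficient of phi /\ beta /\ beta with
    respect to vol. *)
Definition density (p : M) : R := top322 (phi p) (beta p) (beta p) / vol p 1%:M.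

(** Up to a constant, d(f beta^3) = [stokes_density f] vol. *)
Definition stokes_density (f : M -> R) (p : M) : R :=
  f p * density p + top1222 (dfun X f p) (beta p) / vol p 1%:M.

Definition flux (f : M -> R) c (i : 'I_7) (x : 'rV[R]_7) : R :=
  f (crd_inv c x) * vec (bc c x) i.

Lemma C1_vec c i : atlas X c -> C1 (chart_rng c) (fun x => vec (bc c x) i).
Proof.
move=> ac; have oc := open_rng ac; apply: C1_sum => // s.
apply: C1M => //; first exact: C1_cst.
by do 2?[apply: C1M => //]; exact: C1_bc.
Qed.

Lemma C1_flux f c i : C1_fun X f -> atlas X c -> C1 (chart_rng c) (flux f c i).
Proof.
move=> Cf ac; apply: C1M; [exact: open_rng ac|exact: Cf|exact: C1_vec].
Qed.

Lemma multilinear_dfun f p : multilinear (dfun X f p).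
Proof.
move=> i b d U V W; rewrite (ord1 i) /dfun => -> _ _.
by rewrite linearD !linearZ.
Qed.

(** This is div(f v) = f div v + df(v), where v is [vec]: [divergence] and [alt_vec] identify the
    two terms with the two summands of [stokes_density]. *)
Lemma stokes_density_local f c x : C1_fun X f -> atlas X c -> chart_rng c x ->
  stokes_density f (crd_inv c x) * local_vol X vol c x =
  \sum_i 'D_(delta_mx 0 i) (flux f c i) x.
Proof.
move=> Cf ac rx; have D0 := local_vol_neq0 g_vol ac rx.
have J0 : \det (chart_jac X c x) != 0.
  by have := chart_jac_unit ac rx; rewrite unitmxE unitfE.
have v0 : vol (crd_inv c x) 1%:M != 0.
  by apply: contraNneq D0; rewrite (local_volE g_vol ac rx) => ->; rewrite mulr0.
have ab p : alternating_form (beta p) := beta_smooth.1 p.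
have e1 : density (crd_inv c x) * local_vol X vol c x =
    top322 (local_form X phi c x) (local_form X beta c x) (local_form X beta c x).
  by rewrite /density (top322_ratio phi_G2 g_vol) // divfK.
have e2 : top1222 (dfun X f (crd_inv c x)) (beta (crd_inv c x)) / vol (crd_inv c x) 1%:M
    * local_vol X vol c x =
    top1222 (local_form X (dfun X f) c x) (local_form X beta c x).
  rewrite (local_volE g_vol ac rx) /local_form top1222_pullback; last 2 first.
  - exact: multilinear_dfun.
  - by have [] := ab (crd_inv c x).
  by rewrite mulrC -mulrA mulrCA [_ * (_ / _)]mulrA (mulrC (vol _ _)) divfK // mulrC mulrC.
rewrite /stokes_density mulrDl -mulrA e1 e2 -divergence // /top1222 alt_vec.
rewrite big_distrr /= -big_split; apply: eq_bigr => i _ /=.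
have dfx : differentiable (f \o crd_inv c) x by have [d _] := Cf c ac; exact: d.
have df : is_derive x (delta_mx 0 i) (f \o crd_inv c) ('D_(delta_mx 0 i) (f \o crd_inv c) x).
  by apply: DeriveDef => //; exact: diff_derivable.
have dv : is_derive x (delta_mx 0 i) (fun y => vec (bc c y) i)
    ('D_(delta_mx 0 i) (fun y => vec (bc c y) i) x).
  apply: DeriveDef => //; apply: diff_derivable.
  by have [d _] := C1_vec i ac; exact: d.
have [_ fE] := is_derive_mul df dv; rewrite [RHS]fE addrC; congr (_ * _ + _).
rewrite /comp1 (local_dfun Cf ac rx) deriveE //; congr ('d _ _ _).
by apply/rowP => j; rewrite !mxE.
Qed.

End Divergence.

(** * Borel sets of M and measurability in charts *)

Section BorelManifold.
Variables (R : realType) (M : ptopologicalType) (X : manifold R 7 M).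

Lemma borel_open (U : set M) : open U -> measurable (U : set (borel M)).
Proof. by move=> oU; exact: sub_sigma_algebra. Qed.

Lemma borel_closed (K : set M) : closed K -> measurable (K : set (borel M)).
Proof.
move=> cK; rewrite -(setCK K); apply: measurableC.
by apply: borel_open; exact: closed_openC.
Qed.

Lemma continuous_borel (f : M -> R) : continuous f ->
  measurable_fun [set: borel M] (f : borel M -> R).
Proof.
move=> /continuousP cf; apply: measurable_fun_open => U oU.
by apply: borel_open; exact: cf.
Qed.

Definition chart_preimage (c : chart R 7 M) : set (R7 R) := @row7 R @^-1` chart_rng c.

Lemma measurable_chart_preimage c : atlas X c -> measurable (chart_preimage c).
Proof. by move=> ac; apply: measurable_row7_open; exact: open_rng ac. Qed.

Lemma measurable_chart_row7 c (f : 'rV[R]_7 -> R) : atlas X c ->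
  (forall x, chart_rng c x -> {for x, continuous f}) ->
  measurable_fun (chart_preimage c) (f \o @row7 R).
Proof.
move=> ac cf; apply: (measurability _ (measurable_realfun.RGenOpens.measurableE R)).
move=> _ [_ [u [v ->] <-]].
rewrite (_ : _ `&` _ = @row7 R @^-1` (chart_rng c `&` f @^-1` `]u, v[%classic)) //.
apply: measurable_row7_open; rewrite openE => x [rx fx].
have nr : nbhs x (chart_rng c) by apply: open_nbhs_nbhs; split => //; exact: open_rng ac.
apply: filterI => //; apply: (cf x rx).
by apply: open_nbhs_nbhs; split => //; exact: interval_open.
Qed.

Lemma measurable_crd_inv_row7 c : atlas X c ->
  measurable_fun (chart_preimage c) (crd_inv c \o @row7 R : R7 R -> borel M).
Proof.
move=> ac; apply: (measurability (@open M : set (set (borel M)))) => //.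
move=> _ [U oU <-].
rewrite (_ : _ `&` _ = @row7 R @^-1` (chart_rng c `&` crd_inv c @^-1` U)) //.
apply: measurable_row7_open; rewrite openE => x [rx Ux].
have nr : nbhs x (chart_rng c) by apply: open_nbhs_nbhs; split => //; exact: open_rng ac.
apply: filterI => //; apply: (crd_inv_continuous ac rx).
exact: open_nbhs_nbhs.
Qed.

End BorelManifold.

(** * Integrals over the domain of a chart *)

Section ChartIntegral.
Variables (R : realType) (M : ptopologicalType) (X : manifold R 7 M).
Local Notation leb7 := (@lebesgue7_measure R).
Variables (phi : M -> kform R 7 3) (phi_G2 : G2_structure X phi).
Variables (g : M -> 'M[R]_7) (vol : M -> kform R 7 7).
Hypothesis g_vol : forall p, G2_metric_vol (phi p) (g p) (vol p).
Variable mu : {measure set (borel M) -> \bar R}.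
Hypothesis mu_vol : is_riemannian_measure X g mu.

Lemma measurable_local_vol c : atlas X c ->
  measurable_fun (chart_preimage c) (fun t => `|local_vol X vol c (row7 t)|).
Proof.
move=> ac.
apply: (@measurable_chart_row7 _ _ X c (fun x => `|local_vol X vol c x|)) => // x rx.
apply: (@continuous_comp _ _ _ (local_vol X vol c) (@Num.norm R R)).
  exact: (continuous_local_vol phi_G2 g_vol ac rx).
exact: norm_continuous.
Qed.

(** The image of A under [crd c] is rewritten as a preimage under [crd_inv c], the shape that
    [integral_weighted] expects. *)
Lemma riemannian_measure_chart c (A : set (borel M)) : atlas X c ->
  measurable A -> A `<=` chart_dom c ->
  (mu A = \int[leb7]_(t in chart_preimage c `&` (crd_inv c \o @row7 R) @^-1` A)
    (`|local_vol X vol c (row7 t)|)%:E)%E.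
Proof.
move=> ac mA Ac; rewrite (mu_vol ac mA Ac).
have -> : @row7 R @^-1` (crd c @` A) =
    chart_preimage c `&` (crd_inv c \o @row7 R) @^-1` A.
  apply/seteqP; split => t /=.
    by move=> [p Ap pt]; rewrite /chart_preimage /= -pt (crdK ac (Ac _ Ap)); split => //;
      exists p => //; exact: Ac.
  by move=> [/(crd_inv_rng ac)[_ te] At]; exists (crd_inv c (row7 t)).
apply: eq_integral => t; rewrite inE => -[rt _].
by rewrite (sqrt_det_local_metric g_vol ac rt).
Qed.

Lemma integral_chart c (f : borel M -> \bar R) : atlas X c ->
  measurable_fun setT f ->
  (\int[mu]_(p in chart_dom c) f p =
   \int[leb7]_(t in chart_preimage c)
     (f (crd_inv c (row7 t)) * (`|local_vol X vol c (row7 t)|)%:E))%E.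
Proof.
move=> ac mf.
apply: (@integral_weighted _ _ _ (borel M) R leb7 mu (chart_preimage c)
  (chart_dom c) (crd_inv c \o @row7 R) (fun t => `|local_vol X vol c (row7 t)|)).
- exact: measurable_chart_preimage ac.
- by apply: borel_open; exact: open_dom ac.
- exact: measurable_crd_inv_row7 ac.
- by move=> t /(crd_inv_rng ac)[].
- exact: measurable_local_vol.
- by move=> t _.
- by move=> A mA Ac; exact: riemannian_measure_chart.
- exact: measurable_funTS.
Qed.

End ChartIntegral.

(** * Stokes' theorem for a function supported in one coordinate ball *)

Section LocalStokes.
Variables (R : realType) (M : ptopologicalType) (X : manifold R 7 M).
Local Notation leb7 := (@lebesgue7_measure R).
Variables (beta : M -> kform R 7 2) (beta_smooth : smooth_form X beta).
Variables (phi : M -> kform R 7 3) (phi_G2 : G2_structure X phi).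
Hypothesis phi_exact : is_exterior_derivative X beta phi.
Variables (g : M -> 'M[R]_7) (vol : M -> kform R 7 7).
Hypothesis g_vol : forall p, G2_metric_vol (phi p) (g p) (vol p).
Variable mu : {measure set (borel M) -> \bar R}.
Hypothesis mu_vol : is_riemannian_measure X g mu.
Local Notation D := (local_vol X vol).
Local Notation SD := (stokes_density X phi vol beta).

(** In the preferred chart the flux of f vanishes near p, hence so does its divergence, and the
    volume coefficient is nonzero. *)
Lemma stokes_density_near0 f p : C1_fun X f -> (\near p, f p = 0) -> SD f p = 0.
Proof.
move=> Cf nf0; set c := chart_at X p; have ac : atlas X c := atlas_chart_at X p.
have dp : chart_dom c p := dom_chart_at X p.
have rp : chart_rng c (crd c p) by exists p.
have := stokes_density_local phi_G2 g_vol beta_smooth phi_exact Cf ac rp.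
rewrite (crdK ac dp) big1 => [/eqP|i _].
  by rewrite mulf_eq0 (negPf (local_vol_neq0 g_vol ac rp)) orbF => /eqP.
rewrite (@near_eq_derive _ _ _ _ (cst 0)) ?derive_cst //.
have ci := crd_inv_continuous ac rp.
have nf : nbhs (crd_inv c (crd c p)) [set q | f q = 0] by rewrite (crdK ac dp).
have := ci _ nf; rewrite nbhs_simpl /=; apply: filterS => y /= fy.
by rewrite /flux fy mul0r.
Qed.

(** The definition changes chart from point to point through [dfun]. In one fixed chart it is the
    divergence of a C^1 flux over the continuous, nonzero volume coefficient. *)
Lemma continuous_stokes_density f : C1_fun X f -> continuous (SD f).
Proof.
move=> Cf; apply: (@continuous_chart _ _ _ X) => p; set c := chart_at X p.
have ac : atlas X c := atlas_chart_at X p.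
have rp : chart_rng c (crd c p) by exists p => //; exact: dom_chart_at.
pose F (x : 'rV[R]_7) : R := (\sum_i 'D_(delta_mx 0 i) (flux X beta f c i) x) / D c x.
apply: (@continuous_near_eq _ _ F).
  near=> x; have rx : chart_rng c x.
    by near: x; apply: open_nbhs_nbhs; split => //; exact: open_rng ac.
  rewrite /F -(stokes_density_local phi_G2 g_vol beta_smooth phi_exact Cf ac rx).
  by rewrite mulfK //; exact: local_vol_neq0.
apply: continuous_atM; last first.
  by apply: continuous_atV; [exact: local_vol_neq0|exact: (continuous_local_vol phi_G2 g_vol)].
apply: continuous_at_sum => i.
by have [_ cf] := C1_flux beta_smooth i Cf ac; exact: cf.
Unshelve. all: by end_near. Qed.

Section OneChart.
Variables (c : chart R 7 M) (ac : atlas X c) (a : 'rV[R]_7) (r : R).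
Let ball7 := [set x : 'rV[R]_7 | `|x - a| <= r].
Hypothesis ball_rng : ball7 `<=` chart_rng c.
Let K : set M := crd_inv c @` ball7.

Lemma closed_ball7 : closed ball7.
Proof.
apply: (@preimage_closed _ _ (fun x : 'rV[R]_7 => `|x - a|) [set s | s <= r]);
  last exact: closed_le.
move=> x _; apply: (@continuous_comp _ _ _ (fun x : 'rV[R]_7 => x - a) (@Num.norm R _)).
  by apply: continuousB; [exact: cvg_id|exact: cst_continuous].
exact: norm_continuous.
Qed.

Lemma ball7_norm x : ball7 x -> `|x| <= `|a| + r.
Proof.
by move=> xr; rewrite -[x](subrK a) addrC (le_trans (ler_normD _ _)) // lerD2l.
Qed.

Lemma compact_ball7 : compact ball7.
Proof.
apply: bounded_closed_compact; last exact: closed_ball7.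
exists (`|a| + r); split; first exact: num_real.
by move=> s sr x /ball7_norm xr /=; apply: (le_trans xr); rewrite ltW.
Qed.

(** K is the continuous image of a compact ball in a Hausdorff space. *)
Lemma closed_chart_ball : closed K.
Proof.
apply: compact_closed; first exact: manifold_hausdorff X.
apply: continuous_compact compact_ball7; apply: continuous_in_subspaceT => x.
by rewrite inE => /ball_rng rx; exact: (crd_inv_continuous ac rx).
Qed.

Lemma chart_ball_dom : K `<=` chart_dom c.
Proof. by move=> _ [x /ball_rng rx <-]; have [] := crd_inv_rng ac rx. Qed.

Lemma chart_ballP x : chart_rng c x -> K (crd_inv c x) <-> ball7 x.
Proof.
move=> rx; split=> [[y by_ yx]|bx]; last by exists x.
have [_ <-] := crd_inv_rng ac rx; rewrite -yx.
by rewrite (crd_inv_rng ac (ball_rng by_)).2.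
Qed.

(** By compactness the volume coefficient is bounded on the ball, whose Lebesgue measure is finite
    because a box contains it. *)
Lemma measure_chart_ball : (mu (K : set (borel M)) < +oo)%E.
Proof.
have mK : measurable (K : set (borel M)) by apply: (@borel_closed M); exact: closed_chart_ball.
rewrite (riemannian_measure_chart g_vol mu_vol ac mK chart_ball_dom).
have -> : chart_preimage c `&` (crd_inv c \o @row7 R) @^-1` K = @row7 R @^-1` ball7.
  apply/seteqP; split => t /= => [[rt /chart_ballP]|bt]; first exact.
  by split; [exact: ball_rng|exact/chart_ballP/bt/ball_rng].
have mB : measurable (@row7 R @^-1` ball7).
  rewrite -[X in measurable X]setCK; apply: measurableC.
  by apply: (measurable_row7_open (closed_openC closed_ball7)).
have /compact_bounded[B [_ BP]] : compact ((fun x => `|D c x|) @` ball7).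
  apply: continuous_compact compact_ball7; apply: continuous_in_subspaceT => x.
  rewrite inE => /ball_rng rx.
  apply: (@continuous_comp _ _ _ (D c) (@Num.norm R R)); last exact: norm_continuous.
  exact: (continuous_local_vol phi_G2 g_vol ac rx).
have [mbox fbox] := finite_on_box (R := R) (`|a| + r).
have fB : (leb7 (@row7 R @^-1` ball7) < +oo)%E.
  apply: le_lt_trans fbox; apply: le_measure; rewrite ?inE //.
  move=> t bt; apply: contrapT => /notin_box; apply/negP.
  by rewrite -leNgt; exact: ball7_norm.
apply: (@le_lt_trans _ _ ((`|B| + 1)%:E * leb7 (@row7 R @^-1` ball7))%E).
  rewrite -integral_cst //; apply: ge0_le_integral => //.
  - apply/measurable_EFinP.
    apply: (measurable_funS (measurable_chart_preimage ac)).
      by move=> t /ball_rng.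
    exact: (measurable_local_vol phi_G2 g_vol ac).
  - move=> t bt; rewrite lee_fin -[leLHS]normr_id.
    apply: BP; last by exists (row7 t).
    by rewrite (le_lt_trans (ler_norm B)) // ltrDl.
by rewrite lte_mul_pinfty // lee_fin addr_ge0.
Qed.

Section Extension.
Variables (f : M -> R) (Cf : C1_fun X f).
Hypothesis f0 : forall p, ~ K p -> f p = 0.

(** Outside [chart_rng c] the values of [crd_inv c] are meaningless, so the extension by zero has to
    be made explicit. *)
Definition extended_flux i (x : 'rV[R]_7) : R :=
  if pselect (chart_rng c x) then flux X beta f c i x else 0.

Lemma extended_flux_rng i x : chart_rng c x ->
  \near x, flux X beta f c i x = extended_flux i x.
Proof.
move=> rx; near=> y; rewrite /extended_flux; case: pselect => // -[].
by near: y; apply: open_nbhs_nbhs; split => //; exact: open_rng ac.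
Unshelve. all: by end_near. Qed.

Lemma extended_flux_out i x : ~ ball7 x -> extended_flux i x = 0.
Proof.
move=> bx; rewrite /extended_flux; case: pselect => // rx.
by rewrite /flux f0 ?mul0r // => /(chart_ballP rx).
Qed.

Lemma extended_flux_near0 i x : ~ ball7 x -> \near x, cst (0 : R) x = extended_flux i x.
Proof.
move=> bx; near=> y; rewrite extended_flux_out //.
by near: y; apply: open_nbhs_nbhs; split => //; exact/closed_openC/closed_ball7.
Unshelve. all: by end_near. Qed.

(** The open sets [chart_rng c] and the complement of the ball cover R^7; the function is the C^1
    flux on the first and zero on the second. *)
Lemma C1_extended_flux i : C1 setT (extended_flux i).
Proof.
have Cr : C1 (chart_rng c) (extended_flux i).
  apply: (@C1_ext _ _ _ (flux X beta f c i)); [exact: open_rng ac| |].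
    by move=> x /(extended_flux_rng i) /nbhs_singleton.
  exact: C1_flux.
have C0 : C1 (~` ball7) (extended_flux i).
  apply: (@C1_ext _ _ _ (fun=> 0)); [exact/closed_openC/closed_ball7| |exact: C1_cst].
  by move=> x bx; rewrite extended_flux_out.
split=> [x _|v x _]; have [bx|bx] := pselect (ball7 x).
- by have [d _] := Cr; apply: d; exact: ball_rng.
- by have [d _] := C0; apply: d.
- by have [_ d] := Cr; apply: d; exact: ball_rng.
- by have [_ d] := C0; apply: d.
Qed.

Lemma derive_extended_flux i v x : ~ ball7 x -> 'D_v (extended_flux i) x = 0.
Proof.
move=> /(extended_flux_near0 i) e.
by rewrite -(near_eq_derive v e) derive_cst.
Qed.

(** The integration lemmas use balls about the origin, hence the radius |a| + r. *)
Lemma extended_flux_norm i x : `|a| + r < `|x| -> extended_flux i x = 0.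
Proof.
move=> ax; apply: extended_flux_out => /ball7_norm.
by rewrite leNgt ax.
Qed.

(** The constant s stands for the sign of the volume coefficient on the ball. It leaves the integral
    as a factor, and the rest is the divergence of the extended flux. *)
Lemma stokes_chart (s : R) : (forall x, ball7 x -> `|D c x| = s * D c x) ->
  (\int[mu]_p (SD f p)%:E = 0)%E.
Proof.
move=> Ds; have SD0 p : ~ K p -> SD f p = 0.
  move=> Kp; apply: stokes_density_near0 => //; near=> q; apply: f0.
  near: q; apply: open_nbhs_nbhs; split => //.
  exact/closed_openC/closed_chart_ball.
have mSD : measurable_fun [set: borel M] (fun p : borel M => (SD f p)%:E).
  by apply/measurable_EFinP; apply: (@continuous_borel R M); exact: continuous_stokes_density.
transitivity (\int[mu]_(p in (chart_dom c : set (borel M))) (SD f p)%:E)%E.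
  rewrite [RHS]integral_mkcond; apply: eq_integral => p _; rewrite patchE.
  case: ifPn => // /negP; rewrite inE => dp; rewrite SD0 //.
  by move=> /chart_ball_dom.
rewrite (integral_chart phi_G2 g_vol mu_vol ac mSD).
pose G t := s * \sum_i 'D_(delta_mx 0 i) (extended_flux i) (row7 t).
transitivity (\int[leb7]_t (G t)%:E)%E.
  rewrite [LHS]integral_mkcond; apply: eq_integral => t _; rewrite patchE.
  have [bt|bt] := pselect (ball7 (row7 t)).
    have rt := ball_rng bt; rewrite mem_set // -EFinM; congr (_%:E).
    rewrite Ds // mulrCA /G; congr (_ * _).
    rewrite (stokes_density_local phi_G2 g_vol beta_smooth phi_exact Cf ac rt).
    apply: eq_bigr => i _; apply: near_eq_derive; exact: extended_flux_rng.
  rewrite /G big1 ?mulr0 => [|i _]; last exact: derive_extended_flux.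
  case: ifPn => //; rewrite inE => rt.
  by rewrite SD0 ?mul0e // => /(chart_ballP rt).
have int_i i : leb7.-integrable setT
    (fun t => ('D_(delta_mx 0 i) (extended_flux i) (row7 t))%:E).
  have [_ cE] := C1_extended_flux i.
  apply: (integrable_derive_row7 (a := `|a| + r)) => [v x|x]; [exact: cE|].
  exact: extended_flux_norm.
under eq_integral => t _ do rewrite /G EFinM -sumEFin.
have int_s : leb7.-integrable setT
    (fun t => \sum_i ('D_(delta_mx 0 i) (extended_flux i) (row7 t))%:E)%E.
  by apply: (integrable_sum measurableT) => i _; exact: int_i.
rewrite (integralZl measurableT int_s) (integral_sum measurableT int_i) big1 ?mule0 // => i _.
have [dE cE] := C1_extended_flux i.
apply: (@integral_derive_row7 _ (extended_flux i) (`|a| + r)).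
- by move=> x; exact: dE.
- by move=> v x; exact: cE.
- by move=> x; exact: extended_flux_norm.
Unshelve. all: by end_near. Qed.

End Extension.
End OneChart.
End LocalStokes.

(** * C^1 functions and bumps on the manifold *)

Section C1Functions.
Variables (R : realType) (n : nat) (M : topologicalType) (X : manifold R n M).

Lemma C1_fun_continuous (f : M -> R) : C1_fun X f -> continuous f.
Proof.
move=> Cf; apply: (@continuous_chart _ _ _ X) => p; set c := chart_at X p.
have ac : atlas X c := atlas_chart_at X p.
by apply: (C1_continuous (Cf c ac)); exists p => //; exact: dom_chart_at.
Qed.

Lemma C1_fun_sum (I : Type) (s : seq I) (F : I -> M -> R) :
  (forall i, C1_fun X (F i)) -> C1_fun X (fun p => \sum_(i <- s) F i p).
Proof.
move=> CF c ac; apply: (@C1_sum _ _ _ _ s predT (fun i x => F i (crd_inv c x))).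
  exact: open_rng ac.
by move=> i; exact: CF.
Qed.

Lemma C1_fun_div (f h : M -> R) : C1_fun X f -> C1_fun X h ->
  (forall p, h p != 0) -> C1_fun X (fun p => f p / h p).
Proof.
move=> Cf Ch h0 c ac; have oc := open_rng ac.
apply: (@C1M _ _ _ (fun x => f (crd_inv c x)) (fun x => (h (crd_inv c x))^-1)) => //.
  exact: Cf.
by apply: C1V => //; exact: Ch.
Qed.

Section ChartBump.
Variables (c : chart R n M) (ac : atlas X c) (a : 'rV[R]_n) (r : R).
Hypothesis r0 : 0 < r.
Hypothesis ball_rng : [set x | `|x - a| <= r] `<=` chart_rng c.
Hypothesis closedK : closed (crd_inv c @` [set x : 'rV[R]_n | `|x - a| <= r]).
Let K := crd_inv c @` [set x : 'rV[R]_n | `|x - a| <= r].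

Definition chart_bump (p : M) : R :=
  if pselect (chart_dom c p) then bump a r (crd c p) else 0.

Lemma chart_bump_ge0 p : 0 <= chart_bump p.
Proof. by rewrite /chart_bump; case: pselect => [dp|//]; exact: bump_ge0. Qed.

Lemma chart_bump_out p : ~ K p -> chart_bump p = 0.
Proof.
move=> Kp; rewrite /chart_bump; case: pselect => // dp; apply: bump_out => //.
rewrite leNgt; apply/negP => pr; apply: Kp.
by exists (crd c p); [exact: ltW|exact: crdK ac _ dp].
Qed.

(** In another chart, each point lies over the domain of c, where the bump is composed with a
    transition map, or off the closed set K, where it vanishes; both conditions are open. *)
Lemma C1_chart_bump : C1_fun X chart_bump.
Proof.
move=> c' ac'.
have Co : C1 (overlap c' c) (chart_bump \o crd_inv c').
  apply: (@C1_ext _ _ _ (bump a r \o transition c' c)); first exact: open_overlap ac' ac.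
    move=> x /(overlapP _ _ ac')[rx dx].
    by rewrite /chart_bump /transition /=; case: pselect.
  apply: (C1_comp (W := setT)) => //; first exact: open_overlap ac' ac.
    exact: transition_Ck1 ac' ac.
  exact: C1_bump.
pose U := chart_rng c' `&` crd_inv c' @^-1` ~` K.
have oU : open U.
  rewrite openE => x [rx Kx].
  have nr : nbhs x (chart_rng c') by apply: open_nbhs_nbhs; split => //; exact: open_rng ac'.
  apply: filterI => //; apply: (crd_inv_continuous ac' rx).
  by apply: open_nbhs_nbhs; split => //; exact: closed_openC.
have CU : C1 U (chart_bump \o crd_inv c').
  apply: (@C1_ext _ _ _ (fun=> 0)) => //; last exact: C1_cst.
  by move=> x [_ Kx] /=; rewrite chart_bump_out.
have cov x : chart_rng c' x -> overlap c' c x \/ U x.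
  move=> rx; have [dx|dx] := pselect (chart_dom c (crd_inv c' x)).
    by left; apply/(overlapP _ _ ac').
  right; split => // -[y /ball_rng ry yx]; apply: dx; rewrite -yx.
  by have [] := crd_inv_rng ac ry.
split=> [x rx|v x rx]; have [ox|Ux] := cov x rx.
- by have [d _] := Co; exact: d.
- by have [d _] := CU; exact: d.
- by have [_ d] := Co; exact: d.
- by have [_ d] := CU; exact: d.
Qed.

End ChartBump.
End C1Functions.

Lemma measure_bigsetU_lty d (T : measurableType d) (R : realType)
    (mu : {measure set T -> \bar R}) (I : Type) (s : seq I) (K : I -> set T) :
  (forall i, measurable (K i)) -> (forall i, mu (K i) < +oo)%E ->
  (mu (\big[setU/set0]_(i <- s) K i) < +oo)%E.
Proof.
move=> mK fK; elim: s => [|i s IH]; first by rewrite big_nil measure0 ltry.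
rewrite big_cons; apply: le_lt_trans (lte_add_pinfty (fK i) IH).
by apply: measureU2 => //; apply: bigsetU_measurable.
Qed.

(** * Stokes' theorem on the compact manifold *)

Section GlobalStokes.
Variables (R : realType) (M : ptopologicalType) (X : manifold R 7 M).
Hypothesis M_compact : compact [set: M].
Variables (beta : M -> kform R 7 2) (beta_smooth : smooth_form X beta).
Variables (phi : M -> kform R 7 3) (phi_G2 : G2_structure X phi).
Hypothesis phi_exact : is_exterior_derivative X beta phi.
Variables (g : M -> 'M[R]_7) (vol : M -> kform R 7 7).
Hypothesis g_vol : forall p, G2_metric_vol (phi p) (g p) (vol p).
Variable mu : {measure set (borel M) -> \bar R}.
Hypothesis mu_vol : is_riemannian_measure X g mu.
Local Notation SD := (stokes_density X phi vol beta).

(** On a small ball the coordinate volume density has a constant sign s, so that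
    the Riemannian measure is s vol there. *)
Lemma constant_sign_ball p (c := chart_at X p) (a := crd c p) : exists r : R,
  [/\ 0 < r, [set x | `|x - a| <= r] `<=` chart_rng c &
    exists s, forall x, `|x - a| <= r -> `|local_vol X vol c x| = s * local_vol X vol c x].
Proof.
have ac : atlas X c := atlas_chart_at X p.
have ra : chart_rng c a by exists p => //; exact: dom_chart_at.
have D0 := local_vol_neq0 g_vol ac ra; have cD := continuous_local_vol phi_G2 g_vol ac ra.
have [s sD] : exists s, \forall x \near a,
    `|local_vol X vol c x| = s * local_vol X vol c x.
  have [Dn|Dp] : local_vol X vol c a < 0 \/ 0 < local_vol X vol c a.
    by apply/orP; rewrite -neq_lt.
  - exists (-1); apply: filterS (cvgr_lt _ cD _ Dn) => x Dx.
    by rewrite mulN1r; exact: ltr0_norm Dx.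
  - exists 1; apply: filterS (cvgr_gt _ cD _ Dp) => x Dx.
    by rewrite mul1r; exact: gtr0_norm Dx.
have nr : nbhs a (chart_rng c) by apply: open_nbhs_nbhs; split => //; exact: open_rng ac.
have [e /= e0 be] := proj1 (nbhs_ballP _ _) (filterI nr sD).
have bx x : `|x - a| <= e / 2 -> ball a e x.
  move=> xa; rewrite -ball_normE /ball_ /= distrC (le_lt_trans xa) //.
  by rewrite ltr_pdivrMr // ltr_pMr // ltr1n.
exists (e / 2); split; first by rewrite divr_gt0.
- by move=> x /bx /be[].
- by exists s => x /bx /be[].
Qed.

Let rad p := sval (cid (constant_sign_ball p)).
Let c p := chart_at X p.
Let a p := crd (c p) p.
Let K p : set M := crd_inv (c p) @` [set x | `|x - a p| <= rad p].
Let psi p := chart_bump (c p) (a p) (rad p).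

Let rad0 p : 0 < rad p.
Proof. by rewrite /rad; case: cid => r []. Qed.

Let ball_rng p : [set x | `|x - a p| <= rad p] `<=` chart_rng (c p).
Proof. by rewrite /rad; case: cid => r []. Qed.

Let closedK p : closed (K p).
Proof. by apply: (closed_chart_ball (atlas_chart_at X p)); exact: ball_rng. Qed.

Let psi_out p q : ~ K p q -> psi p q = 0.
Proof. by apply: chart_bump_out => //; exact: atlas_chart_at. Qed.

Let C1_psi p : C1_fun X (psi p).
Proof.
apply: C1_chart_bump; [exact: atlas_chart_at|exact: rad0|exact: ball_rng|exact: closedK].
Qed.

(** Compactness is applied to the open sets where the bumps are positive, so that the sum of the
    selected bumps has no zero and can be divided by. *)
Lemma finite_cover : exists s : seq M, forall q, exists2 p, p \in s & 0 < psi p q.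
Proof.
move: M_compact; rewrite compact_cover => /(_ M setT (fun p => [set q | 0 < psi p q])).
case=> [p _|q _|s _ sP].
- have /continuousP cpsi := C1_fun_continuous (C1_psi p).
  by apply: (cpsi [set y | 0 < y]); exact: open_gt.
- exists q => //=; rewrite /psi /chart_bump; case: pselect => [dp|[]]; last exact: dom_chart_at.
  exact: bump_center.
by exists (finmap.enum_fset s) => q; have [p ps pq] := sP q I; exists p.
Qed.

(** Finitely many coordinate balls cover M, since a point with a positive bump lies in the
    corresponding ball. *)
Lemma finite_measure : (mu setT < +oo)%E.
Proof.
have [s sP] := finite_cover.
have mK p : measurable (K p : set (borel M)) by exact: borel_closed.
have fK p : (mu (K p : set (borel M)) < +oo)%E.
  apply: (measure_chart_ball phi_G2 g_vol mu_vol); first exact: atlas_chart_at.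
  exact: ball_rng.
have mU : measurable (\big[setU/set0]_(p <- s) K p : set (borel M)).
  by apply: bigsetU_measurable => p _; exact: mK.
have := measure_bigsetU_lty s mK fK; apply: le_lt_trans.
apply: le_measure; [apply: mem_set; exact: measurableT|exact: mem_set|].
move=> q _; have [p ps pq] := sP q; rewrite -bigcup_seq; exists p => //.
by apply: contrapT => /psi_out e; rewrite e ltxx in pq.
Qed.

Lemma continuous_integrable (f : M -> R) : continuous f ->
  mu.-integrable [set: borel M] (fun p => (f p)%:E).
Proof.
move=> cf; apply: (measurable_bounded_integrable _ finite_measure) => //.
  exact: continuous_borel.
have /compact_bounded[B [Br BP]] : compact (f @` [set: M]).
  by apply: continuous_compact => //; exact: continuous_subspaceT.
by exists B; split => // y By p _; apply: BP => //; exists p.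
Qed.

Lemma integral_density0 : (\int[mu]_p (density phi vol beta p)%:E = 0)%E.
Proof.
have [s sP] := finite_cover.
pose Psi q := \sum_(p <- s) psi p q.
have Psi0 q : 0 < Psi q.
  have [p ps pq] := sP q; rewrite /Psi (big_rem p) //=.
  by apply: ltr_wpDr => //; apply: sumr_ge0 => i _; exact: chart_bump_ge0.
have C1Psi : C1_fun X Psi by exact: C1_fun_sum.
pose f p q := psi p q / Psi q.
have C1f p : C1_fun X (f p) by apply: (C1_fun_div (C1_psi p) C1Psi) => q; rewrite gt_eqF.
have sumf q : \sum_(p <- s) f p q = 1.
  by rewrite /f -mulr_suml; apply/divff/lt0r_neq0/Psi0.
have intf p : (\int[mu]_q (SD (f p) q)%:E = 0)%E.
  have [s0 s0P] : exists s, forall x, `|x - a p| <= rad p ->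
      `|local_vol X vol (c p) x| = s * local_vol X vol (c p) x.
    by rewrite /rad; case: cid => r [].
  apply: (stokes_chart beta_smooth phi_G2 phi_exact g_vol mu_vol
    (atlas_chart_at X p) (@ball_rng p) (C1f p) _ s0P).
  by move=> q Kq; rewrite /f psi_out ?mul0r.
(* Since the f_p sum to 1, the first summands add up to the density, while the second ones contain
   the sum of the df_p, which is the derivative of a constant. *)
have sumSD q : density phi vol beta q = \sum_(p <- s) SD (f p) q.
  rewrite big_split /= -mulr_suml sumf mul1r -mulr_suml.
  rewrite [X in _ + X / _](_ : _ = 0) ?mul0r ?addr0 //.
  rewrite /top1222; under eq_bigr => p _ do rewrite alt_vec.
  rewrite exchange_big big1 //= => i _; rewrite -mulr_suml.
  have dcq := dom_chart_at X q; have acq := atlas_chart_at X q.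
  have rq : chart_rng (c q) (a q) by exists q.
  rewrite [X in X * _](_ : _ = 0) ?mul0r //.
  pose w := row 0 (delta_mx 0 i : 'rV[R]_7).
  have df p : is_derive (a q) w (f p \o crd_inv (c q)) ('D_w (f p \o crd_inv (c q)) (a q)).
    apply: DeriveDef => //; apply: diff_derivable.
    by have [d _] := C1f p _ acq; exact: d.
  have [_ fE] := is_derive_bigsum s predT df.
  transitivity ('D_w (fun y => \sum_(p <- s) (f p \o crd_inv (c q)) y) (a q)).
    rewrite fE; apply: eq_bigr => p _; rewrite /comp1 /dfun deriveE //.
    by have [d _] := C1f p _ acq; exact: d.
  transitivity ('D_w (cst (1 : R)) (a q)); last exact: derive_cst.
  by congr ('D_w _ _); apply/funext => y; exact: sumf.
under eq_integral => q _ do rewrite sumSD -sumEFin.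
rewrite integral_sum //; first by rewrite big1.
by move=> p; apply: continuous_integrable; exact: continuous_stokes_density.
Qed.

End GlobalStokes.

Theorem theorem3p2 (R : realType) (M : ptopologicalType) (X : manifold R 7 M)
    (M_compact : compact [set: M])
    (beta : M -> kform R 7 2) (beta_smooth : smooth_form X beta)
    (phi : M -> kform R 7 3) (phi_G2 : G2_structure X phi)
    (phi_exact : is_exterior_derivative X beta phi)
    (g : M -> 'M[R]_7) (vol : M -> kform R 7 7)
    (g_vol : forall p, G2_metric_vol (phi p) (g p) (vol p))
    (mu : {measure set (borel M) -> \bar R})
    (mu_vol : is_riemannian_measure X g mu)
    (beta7 beta14 : M -> kform R 7 2)
    (beta7_in : Omega2_7 X phi g vol beta7)
    (beta14_in : Omega2_14 X phi g vol beta14)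
    (beta_split : forall p V, beta p V = beta7 p V + beta14 p V) :
  (2%:E * L2_norm2 g mu beta7)%E = L2_norm2 g mu beta14.
Proof.
(* The factors combine 24 = 3! 2! 2! with the eigenvalues 2 and -1. *)
have ptE p : [/\ form_norm2 (g p) (beta7 p) = density phi vol beta7 p / 48,
    form_norm2 (g p) (beta14 p) = - density phi vol beta14 p / 24 &
    density phi vol beta p =
      24 * (2 * form_norm2 (g p) (beta7 p) - form_norm2 (g p) (beta14 p))].
  have [A uA [phiE gE volE]] := g_vol p.
  have h7 := beta7_in.2 p; have h14 := beta14_in.2 p; rewrite gE in h7 h14 *.
  have A0 : \det A != 0 by rewrite -unitfE -unitmxE.
  have v1 : vol p 1%:M = \det A by rewrite volE /pullback mul1mx.
  have bE : beta p = (fun V => beta7 p V + beta14 p V) by exact/funext/beta_split.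
  rewrite -(top322_split uA phiE volE h7 h14) -bE.
  rewrite (form_norm2_Lambda2_7 uA phiE volE h7) (form_norm2_Lambda2_14 uA phiE volE h14).
  by rewrite /density v1; split; field; exact: A0.
(* Splitting the integral of the difference requires each norm to be integrable; being multiples of
   densities, they are continuous on the compact M. *)
have int7 : mu.-integrable [set: borel M] (fun p => (form_norm2 (g p) (beta7 p))%:E).
  apply: (continuous_integrable M_compact phi_G2 g_vol mu_vol) => p.
  rewrite (_ : (fun p => _) = fun p => density phi vol beta7 p / 48); last first.
    by apply/funext => q; have [] := ptE q.
  apply: continuous_atM; last exact: cst_continuous.
  exact: (continuous_top322 phi_G2 g_vol beta7_in.1).
have int14 : mu.-integrable [set: borel M] (fun p => (form_norm2 (g p) (beta14 p))%:E).
  apply: (continuous_integrable M_compact phi_G2 g_vol mu_vol) => p.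
  rewrite (_ : (fun p => _) = fun p => density phi vol beta14 p * (- 24^-1)); last first.
    by apply/funext => q; have [_ -> _] := ptE q; rewrite mulrN mulNr.
  apply: continuous_atM; last exact: cst_continuous.
  exact: (continuous_top322 phi_G2 g_vol beta14_in.1).
have int27 : mu.-integrable [set: borel M]
    (fun p => (2%:E * (form_norm2 (g p) (beta7 p))%:E)%E).
  exact: integrableZl.
have := integral_density0 M_compact beta_smooth phi_G2 phi_exact g_vol mu_vol.
rewrite (eq_integral (fun p : borel M => 24%:E * (2%:E * (form_norm2 (g p) (beta7 p))%:E -
  (form_norm2 (g p) (beta14 p))%:E))%E); last first.
  by move=> p _; have [_ _ ->] := ptE p; rewrite EFinM EFinB EFinM.
rewrite integralZl //; last exact: integrableB.
rewrite integralB // integralZl // => /eqP.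
rewrite mule_eq0 eqe pnatr_eq0 /= => /eqP e.
(* In the extended reals, a zero difference gives equality because the subtracted integral is
   finite. *)
by rewrite -[LHS](subeK _ (integrable_fin_num _ int14)) // [X in (X + _)%E]e add0e.
Qed.
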